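(* Let $S$ be any ring, $V$ any $S,S$-bimodule, $I\subseteq T^+_S(V)=\bigoplus_{n\ge 1}V^{\otimes n}$ any (two-sided) ideal, and $A=T^+_S(V)/I$. Let $\mathcal{F}_\bullet(V,I)$ be the differential graded $S$-algebra defined in the context, and let $\rho\colon \mathcal{F}_\bullet(V,I)\to A$ be the morphism of dg algebras ($A$ being concentrated in degree $0$ with zero differential) which is the quotient map $\mathcal{F}_0(V,I)=T^+_S(V)\to T^+_S(V)/I$ in degree $0$ and zero in positive degrees. Then $\rho$ is a quasi-isomorphism; that is, the dg algebra $\mathcal{F}_\bullet(V,I)$ is a free resolution of the algebra $A$.
   Context: All tensor products are over $S$; $V^n$ denotes $V^{\otimes n}$. $S$-algebras are non-unital: an $S$-algebra is an $S,S$-bimodule with an associative multiplication $A\otimes_S A\to A$ of bimodules. $T^+_S(V)=\bigoplus_{n\geq 1}V^n$ is the non-unital tensor algebra; ideals are two-sided and are sub-bimodules. A free resolution of $A$ is a dg $S$-algebra quasi-isomorphic to $A$ whose underlying graded algebra is a non-unital tensor algebra over $S$ on some graded $S,S$-bimodule. Differentials have degree $-1$ and satisfy $d(v\cdot w)=dv\cdot w+(-1)^{\deg v}v\cdot dw$. Bracketings. Let $\mathcal{B}^{( * )}$ be the set of words defined recursively as follows: (i) the word $\bullet$ (an ''input'') and the word $[*]$ (an ''innermost bracket'') belong to $\mathcal{B}^{( * )}$; (ii) if $\beta\in\mathcal{B}^{( * )}$ contains at least one bracket pair and $\beta$ is not itself closed (i.e. is neither $[*]$ nor of the form $[\alpha]$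 with $\alpha\in\mathcal{B}^{( * )}$), then $[\beta]\in\mathcal{B}^{( * )}$; (iii) if $\alpha,\beta\in\mathcal{B}^{( * )}$ then the concatenation $\alpha\beta\in\mathcal{B}^{( * )}$. (The symbol $[*]$ stands simultaneously for all brackets $[\bullet^m]$, $m\ge1$, enclosing only inputs.) For $\beta\in\mathcal{B}^{( * )}$, $(V,I)^\beta$ is the tensor product over $S$, in order from left to right, of one copy of $V$ for each $\bullet$ and one copy of $I$ for each $[*]$ in $\beta$. It is placed in homological degree equal to the number of bracket pairs in $\beta$ (each $[*]$ counting as one pair). Put $$\mathcal{F}_\bullet(V,I)=\bigoplus_{\beta\in\mathcal{B}^{( * )}}(V,I)^\beta .$$ In particular $\mathcal{F}_0(V,I)=\bigoplus_{n\ge1}V^n=T^+_S(V)$. Product: the tautological identifications $(V,I)^\alpha\otimes(V,I)^\beta\to(V,I)^{\alpha\beta}$ (concatenation). Differential: on $(V,I)^\beta$ with $\beta$ having $n$ bracket pairs, $d=\sum_{m=1}^n(-1)^{m-1}\partial_m$, where $\partial_m$ corresponds to removing the $m$th left bracket of $\beta$ (counted from the left) with its matching right bracket: - if that pair is not a $[*]$, $\partial_m$ is the tautological identity map onto the summand of the bracketing with that pair removed; - if that pair is a $[*]$ which occurs in $\beta$ inside a pair of matching brackets whose whole content is $\bullet^a[*]\bullet^b$ (with $a+b\ge1$), then $[\bullet^a[*]\bullet^b]$ is replaced by $[*]$ and $\partial_m$ is induced by the multiplication map $V^a\otimes I\otimes V^b\to I$; - otherwise, $\partial_m$ is induced by the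 inclusion $I\to T^+_S(V)=\bigoplus_{j\ge1}V^j$, the component in $V^j$ landing in the summand of the bracketing in which this $[*]$ is replaced by $\bullet^j$. The image of $d\colon\mathcal{F}_1(V,I)\to\mathcal{F}_0(V,I)$ is $I$. *)

(* Defs.v *)
From HB Require Import structures.
From mathcomp Require Import all_boot all_algebra.
From mathcomp Require Import boolp freeg.

Set Implicit Arguments.
Unset Strict Implicit.
Unset Printing Implicit Defensive.

Import GRing.Theory.
Local Open Scope ring_scope.
Local Open Scope quotient_scope.

HB.mixin Record Lmodule_isBimodule (S : pzRingType) V of GRing.Lmodule S V := {
  ract : V -> S -> V;
  ractDl : forall (s : S) (x y : V), ract (x + y) s = ract x s + ract y s;
  ractDr : forall (x : V) (s t : S), ract x (s + t) = ract x s + ract x t;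
  ractA : forall (x : V) (s t : S), ract (ract x s) t = ract x (s * t);
  ract1 : forall x : V, ract x 1 = x;
  scale_ract : forall (s t : S) (x : V), s *: ract x t = ract (s *: x) t;
}.
#[short(type="bimodType")]
HB.structure Definition Bimodule (S : pzRingType) :=
  {V of Lmodule_isBimodule S V & GRing.Lmodule S V}.

(* A bimodule map A (x)_S A -> A is an S-balanced biadditive map compatible
   with the two outer actions. *)
HB.mixin Record Bimodule_isNonUnitalAlgebra (S : pzRingType) A of Bimodule S A := {
  amul : A -> A -> A;
  amulDl : forall z x y : A, amul (x + y) z = amul x z + amul y z;
  amulDr : forall x y z : A, amul x (y + z) = amul x y + amul x z;
  amul_balanced : forall (s : S) (x y : A), amul (ract x s) y = amul x (s *: y);
  amul_scalel : forall (s : S) (x y : A), amul (s *: x) y = s *: amul x y;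
  amul_ractr : forall (s : S) (x y : A), amul x (ract y s) = ract (amul x y) s;
  amulA : forall x y z : A, amul x (amul y z) = amul (amul x y) z;
}.
#[short(type="nuAlgType")]
HB.structure Definition NonUnitalAlgebra (S : pzRingType) :=
  {A of Bimodule_isNonUnitalAlgebra S A & Bimodule S A}.

Section BimoduleTheory.
Variables (S : pzRingType) (V : bimodType S).
Implicit Types (x y : V) (s t : S).

Lemma ract0l s : ract (0 : V) s = 0.
Proof. by apply: (addrI (ract (0 : V) s)); rewrite -ractDl !addr0. Qed.
Lemma ractNl s x : ract (- x) s = - ract x s.
Proof. by apply: (addrI (ract x s)); rewrite -ractDl !subrr ract0l. Qed.
Lemma ractBl s x y : ract (x - y) s = ract x s - ract y s.
Proof. by rewrite ractDl ractNl. Qed.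
End BimoduleTheory.

Section AlgebraTheory.
Variables (S : pzRingType) (A : nuAlgType S).
Implicit Types (x y : A).

Lemma amul0l x : amul 0 x = 0.
Proof. by apply: (addrI (amul 0 x)); rewrite -amulDl !addr0. Qed.
Lemma amul0r x : amul x 0 = 0.
Proof. by apply: (addrI (amul x 0)); rewrite -amulDr !addr0. Qed.
Lemma amulNl y x : amul (- x) y = - amul x y.
Proof. by apply: (addrI (amul x y)); rewrite -amulDl !subrr amul0l. Qed.
Lemma amulNr y x : amul y (- x) = - amul y x.
Proof. by apply: (addrI (amul y x)); rewrite -amulDr !subrr amul0r. Qed.
End AlgebraTheory.

Section SpanAdditive.
Variables (A : zmodType) (R : A -> Prop).

(* The additive subgroup generated by R. *)
Inductive span : A -> Prop :=
| span_gen x : R x -> span x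
| span0 : span 0
| spanB x y : span x -> span y -> span (x - y).

Definition span_pred : {pred A} := fun x => `[< span x >].

Lemma span_predP x : reflect (span x) (x \in span_pred).
Proof. exact: asboolP. Qed.

Fact span_zmod_closed : zmod_closed span_pred.
Proof.
split; first by apply/span_predP; exact: span0.
by move=> x y /span_predP hx /span_predP hy; apply/span_predP; exact: spanB.
Qed.
HB.instance Definition _ :=
  GRing.isZmodClosed.Build A span_pred span_zmod_closed.
End SpanAdditive.

Section AdditiveExtension.
Variables (K : choiceType) (A : zmodType).

(* The additive extension of f : K -> A to the free abelian group on K. *)
Definition ext (f : K -> A) (D : {freeg K / int}) : A :=
  fglift (M := zmodule A) f D.

Lemma extB f : zmod_morphism (ext f).
Proof. exact: (@lift_is_additive int K (zmodule A) f). Qed.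
Lemma extU f k : ext f << k >> = f k.
Proof. by rewrite /ext liftU scale1r. Qed.
End AdditiveExtension.

HB.instance Definition _ (K : choiceType) (A : zmodType) (f : K -> A) :=
  GRing.isZmodMorphism.Build _ _ (ext f) (@extB K A f).

(* Index sets for sums of tensor products: an admissible shape j contributes the
   tensor product of bimodules labelled by (letters j), in degree (degree j), and
   concatenation of shapes indexes the product of the algebra tensor_sum below. *)
Record shapes (L : choiceType) := Shapes {
  shape :> choiceType;
  admissible : pred shape;
  letters : shape -> seq L;
  cat_shape : shape -> shape -> shape;
  degree : shape -> nat;
  letters_neq0 : forall j, admissible j -> letters j != [::];
  cat_admissible : forall i j,
    admissible i -> admissible j -> admissible (cat_shape i j);
  letters_cat : forall i j, admissible i -> admissible j ->
    letters (cat_shape i j) = letters i ++ letters j;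
  degree_cat : forall i j, admissible i -> admissible j ->
    degree (cat_shape i j) = (degree i + degree j)%N;
  cat_shapeA : associative cat_shape;
}.

Section TensorSum.
Variables (S : pzRingType) (L : choiceType) (M : L -> bimodType S).
Variable X : shapes L.

Definition letter := {i : L & M i}.
Definition mkletter i (x : M i) : letter := Tagged M x.
Implicit Types (j : X) (l : seq letter) (s t : S).

Definition word_ok j l := admissible j && (map tag l == letters j).

Local Notation word := (X * seq letter)%type.

(* The free abelian group on all pairs (j, l) modulo these relators is the
   direct sum over the admissible shapes j of the tensor product over S of the
   bimodules M i, i running through (letters j) from left to right. *)
Inductive tensor_relator : {freeg word / int} -> Prop :=
| relator_shape j l : ~~ word_ok j l -> tensor_relator << (j, l) >>
| relator_add j l1 l2 i (x y : M i) :
    tensor_relator (<< (j, l1 ++ mkletter (x + y) :: l2) >>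
      - (<< (j, l1 ++ mkletter x :: l2) >> + << (j, l1 ++ mkletter y :: l2) >>))
| relator_balance j l1 l2 i k (x : M i) s (y : M k) :
    tensor_relator (<< (j, l1 ++ mkletter (ract x s) :: mkletter y :: l2) >>
      - << (j, l1 ++ mkletter x :: mkletter (s *: y) :: l2) >>).

Local Notation Quot := (Quotient.quot (span_pred tensor_relator)).

Definition tensor_sum : Type := Quot.
HB.instance Definition _ := GRing.Zmodule.on tensor_sum.

Definition pure j l : tensor_sum :=
  \pi_Quot << (j, l) >>.

(* The additive extension of a function of pure tensors. It is meaningful when
   f is multilinear and balanced, see tensor_liftE. *)
Definition tensor_lift (A : zmodType) (f : X -> seq letter -> A)
  (x : tensor_sum) : A :=
  ext (fun p : word => if word_ok p.1 p.2 then f p.1 p.2 else 0) (repr (x : Quot)).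

Definition multilinear (A : zmodType) (f : X -> seq letter -> A) : Prop :=
  (forall j l1 l2 i (x y : M i), word_ok j (l1 ++ mkletter x :: l2) ->
     f j (l1 ++ mkletter (x + y) :: l2)
     = f j (l1 ++ mkletter x :: l2) + f j (l1 ++ mkletter y :: l2)) /\
  (forall j l1 l2 i k (x : M i) s (y : M k),
     word_ok j (l1 ++ mkletter x :: mkletter y :: l2) ->
     f j (l1 ++ mkletter (ract x s) :: mkletter y :: l2)
     = f j (l1 ++ mkletter x :: mkletter (s *: y) :: l2)).

Lemma pi_relator D : tensor_relator D -> \pi_Quot D = 0.
Proof.
move=> hD; rewrite -(raddf0 \pi_Quot).
by apply/eqP; rewrite -Quotient.idealrBE subr0; apply/span_predP/span_gen.
Qed.

Lemma pure_eq0 j l : ~~ word_ok j l -> pure j l = 0.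
Proof. by move=> h; apply: pi_relator; constructor. Qed.

Lemma pure_add j l1 l2 i (x y : M i) : pure j (l1 ++ mkletter (x + y) :: l2)
  = pure j (l1 ++ mkletter x :: l2) + pure j (l1 ++ mkletter y :: l2).
Proof.
apply/eqP; rewrite -subr_eq0 -!raddfD -raddfB; apply/eqP.
by apply: pi_relator; constructor.
Qed.

Lemma pure_balance j l1 l2 i k (x : M i) s (y : M k) :
  pure j (l1 ++ mkletter (ract x s) :: mkletter y :: l2)
  = pure j (l1 ++ mkletter x :: mkletter (s *: y) :: l2).
Proof.
apply/eqP; rewrite -subr_eq0 -raddfB; apply/eqP.
by apply: pi_relator; constructor.
Qed.

Lemma word_ok_tag j l m : map tag l = map tag m -> word_ok j l = word_ok j m.
Proof. by rewrite /word_ok => ->. Qed.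

Lemma tensor_sum_ind (P : tensor_sum -> Prop) :
  P 0 -> (forall x y, P x -> P y -> P (x - y)) ->
  (forall j l, word_ok j l -> P (pure j l)) -> forall x, P x.
Proof.
move=> P0 PB Pp x.
have PN y : P y -> P (- y) by move=> hy; rewrite -[- y]add0r; apply: PB.
have PD y z : P y -> P z -> P (y + z).
  by move=> hy hz; rewrite -[z]opprK; apply: PB => //; apply: PN.
have PM y n : P y -> P (y *+ n).
  by move=> hy; elim: n => [|n IHn]; rewrite ?mulr0n ?mulrS //; apply: PD.
have PZ y (c : int) : P y -> P (y *~ c).
  by case: c => n hy; [exact: PM | rewrite NegzE mulrNz; apply/PN/PM].
rewrite -[x](@reprK _ Quot).
rewrite -[repr x]freeg_sumE raddf_sum; elim/big_ind: _ => // -[j l] _.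
rewrite -[coeff _ _]intz -freegU_mulz raddfMz /=; apply: PZ.
rewrite -/(pure j l); case: (boolP (word_ok j l)) => [/Pp //|/pure_eq0 ->].
exact: P0.
Qed.

Section Lift.
Variables (A : zmodType) (f : X -> seq letter -> A).
Hypothesis fM : multilinear f.

Let g (p : word) : A := if word_ok p.1 p.2 then f p.1 p.2 else 0.

Lemma tensor_lift_pi D : tensor_lift f (\pi_Quot D) = ext g D.
Proof.
have : repr (\pi_Quot D) - D \in span_pred tensor_relator.
  by rewrite Quotient.idealrBE reprK.
rewrite /tensor_lift -/g => /span_predP h.
apply/eqP; rewrite -subr_eq0 -raddfB; apply/eqP.
elim: h => [r|//|x y _ ihx _ ihy]; rewrite ?raddf0 ?raddfB ?ihx ?ihy ?subr0 //.
case: fM => fD fB.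
case=> [j l /negbTE h|j l1 l2 i x y|j l1 l2 i k x s y].
- by rewrite /= extU /g /= h.
- rewrite raddfB raddfD /= !extU /g /=.
  rewrite !(@word_ok_tag _ (l1 ++ mkletter (x + y) :: l2)
              (l1 ++ mkletter x :: l2)) ?(@word_ok_tag _ (l1 ++ mkletter y :: l2)
              (l1 ++ mkletter x :: l2)) ?map_cat //.
  by case: ifP => h; rewrite ?fD ?subrr // addr0 subrr.
- rewrite raddfB /= !extU /g /=.
  rewrite !(@word_ok_tag _ (l1 ++ mkletter (ract x s) :: mkletter y :: l2)
              (l1 ++ mkletter x :: mkletter y :: l2)) ?map_cat //.
  rewrite !(@word_ok_tag _ (l1 ++ mkletter x :: mkletter (s *: y) :: l2)
              (l1 ++ mkletter x :: mkletter y :: l2)) ?map_cat //.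
  by case: ifP => h; rewrite ?fB ?subrr.
Qed.

Lemma tensor_liftE j l : word_ok j l -> tensor_lift f (pure j l) = f j l.
Proof. by move=> h; rewrite tensor_lift_pi extU /g h. Qed.

Lemma tensor_liftB : zmod_morphism (tensor_lift f).
Proof.
move=> x y; rewrite -[x](@reprK _ Quot) -[y](@reprK _ Quot) -raddfB.
by rewrite !tensor_lift_pi raddfB.
Qed.
End Lift.

Lemma tensor_sum_eq (A : zmodType) (f g : tensor_sum -> A) :
  zmod_morphism f -> zmod_morphism g ->
  (forall j l, word_ok j l -> f (pure j l) = g (pure j l)) -> f =1 g.
Proof.
move=> fB gB fg; elim/tensor_sum_ind => [|x y fx fy|//].
  by rewrite -(subrr 0) fB gB !subrr.
by rewrite fB gB fx fy.
Qed.

Definition lscale s l : seq letter :=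
  if l is x :: l' then mkletter (s *: tagged x) :: l' else [::].

Fixpoint rscale l s : seq letter :=
  match l with
  | [::] => [::]
  | [:: x] => [:: mkletter (ract (tagged x) s)]
  | x :: l' => x :: rscale l' s
  end.

Lemma tag_lscale s l : map tag (lscale s l) = map tag l.
Proof. by case: l. Qed.

Lemma tag_rscale l s : map tag (rscale l s) = map tag l.
Proof. by elim: l => [|x [|y l] IHl] //=; congr (_ :: _); exact: IHl. Qed.

Lemma rscale_cat l1 l2 s : l2 != [::] -> rscale (l1 ++ l2) s = l1 ++ rscale l2 s.
Proof.
move=> l2n0; elim: l1 => [|x l1 IH] //=; rewrite -IH.
by case: l1 {IH} => [|//]; case: l2 l2n0.
Qed.

Definition tscale s (x : tensor_sum) : tensor_sum :=
  tensor_lift (fun j l => pure j (lscale s l)) x.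
Definition tract (x : tensor_sum) s : tensor_sum :=
  tensor_lift (fun j l => pure j (rscale l s)) x.

Lemma tscale_multilinear s : multilinear (fun j l => pure j (lscale s l)).
Proof.
split=> [j [|z l1] l2 i x y _|j [|z l1] l2 i k x t y _] /=.
- by rewrite /= scalerDr (pure_add _ [::]).
- by rewrite (pure_add _ (_ :: _)).
- by rewrite scale_ract (pure_balance _ [::]).
- by rewrite (pure_balance _ (_ :: _)).
Qed.

Lemma tract_multilinear s : multilinear (fun j l => pure j (rscale l s)).
Proof.
split=> [j l1 l2 i x y _|j l1 l2 i k x t y _] /=.
- rewrite !rscale_cat //=; case: l2 => [|z l2]; last exact: pure_add.
  by rewrite /= ractDl pure_add.
- rewrite !rscale_cat //=; case: l2 => [|z l2]; last exact: pure_balance.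
  by rewrite /= pure_balance scale_ract.
Qed.

Lemma word_ok_lscale s j l : word_ok j (lscale s l) = word_ok j l.
Proof. by rewrite /word_ok tag_lscale. Qed.
Lemma word_ok_rscale s j l : word_ok j (rscale l s) = word_ok j l.
Proof. by rewrite /word_ok tag_rscale. Qed.

Lemma tscaleB s : zmod_morphism (tscale s).
Proof. exact: (tensor_liftB (tscale_multilinear s)). Qed.
Lemma tractB s : zmod_morphism (tract^~ s).
Proof. exact: (tensor_liftB (tract_multilinear s)). Qed.

Lemma word_ok_neq0 j l : word_ok j l -> l != [::].
Proof.
by case/andP => /letters_neq0 h /eqP e; apply: contra h => /eqP el; rewrite -e el.
Qed.

Lemma word_ok_nil j : word_ok j [::] = false.
Proof. by apply/negP => /word_ok_neq0; rewrite eqxx. Qed.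

Lemma tscale0 s : tscale s 0 = 0.
Proof. by rewrite -(subrr 0) tscaleB !subrr. Qed.
Lemma tract0 s : tract 0 s = 0.
Proof. by rewrite -(subrr 0) tractB !subrr. Qed.

Lemma tscaleE s j l : tscale s (pure j l) = pure j (lscale s l).
Proof.
have [h|h] := boolP (word_ok j l); first exact: (tensor_liftE (tscale_multilinear s)).
by rewrite !pure_eq0 ?word_ok_lscale // tscale0.
Qed.

Lemma tractE s j l : tract (pure j l) s = pure j (rscale l s).
Proof.
have [h|h] := boolP (word_ok j l); first exact: (tensor_liftE (tract_multilinear s)).
by rewrite !pure_eq0 ?word_ok_rscale // tract0.
Qed.

Fact tscaleA s t x : tscale s (tscale t x) = tscale (s * t) x.
Proof.
elim/tensor_sum_ind: x => [|x y hx hy|j [|[i x] l] _].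
- by rewrite -(subrr 0) !tscaleB !subrr.
- by rewrite !tscaleB hx hy.
- by rewrite !tscaleE.
- by rewrite !tscaleE /= scalerA.
Qed.

Fact tscale1 : left_id 1 tscale.
Proof.
elim/tensor_sum_ind => [|x y hx hy|j [|[i x] l] _].
- by rewrite -(subrr 0) tscaleB !subrr.
- by rewrite tscaleB hx hy.
- by rewrite tscaleE.
- by rewrite tscaleE /= scale1r.
Qed.

Fact tscaleDr : right_distributive tscale +%R.
Proof.
move=> s x y; have sN z : tscale s (- z) = - tscale s z.
  by rewrite -sub0r tscaleB -(subrr 0) tscaleB subrr sub0r.
by rewrite -{1}[y]opprK tscaleB sN opprK.
Qed.

Fact tscaleDl x : {morph tscale^~ x : s t / s + t}.
Proof.
move=> s t; elim/tensor_sum_ind: x => [|x y hx hy|j [|[i x] l] ok] /=.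
- by rewrite -(subrr 0) !tscaleB !subrr addr0.
- by rewrite !tscaleB hx hy addrACA opprD.
- by move: ok; rewrite word_ok_nil.
- by rewrite !tscaleE /= scalerDl (pure_add _ [::]).
Qed.

HB.instance Definition _ := GRing.Zmodule_isLmodule.Build S tensor_sum
  tscaleA tscale1 tscaleDr tscaleDl.

Fact tractDl s x y : tract (x + y) s = tract x s + tract y s.
Proof.
have sN z : tract (- z) s = - tract z s.
  by rewrite -sub0r tractB -(subrr 0) tractB subrr sub0r.
by rewrite -{1}[y]opprK tractB sN opprK.
Qed.

Fact tractDr x s t : tract x (s + t) = tract x s + tract x t.
Proof.
elim/tensor_sum_ind: x => [|x y hx hy|j l ok] /=.
- by rewrite -(subrr 0) !tractB !subrr addr0.
- by rewrite !tractB hx hy addrACA opprD.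
case/lastP: l ok => [|l [i x] _]; first by rewrite word_ok_nil.
by rewrite !tractE -cats1 !rscale_cat //= ractDr pure_add.
Qed.

Fact tractA x s t : tract (tract x s) t = tract x (s * t).
Proof.
elim/tensor_sum_ind: x => [|x y hx hy|j l ok] /=.
- by rewrite -(subrr 0) !tractB !subrr.
- by rewrite !tractB hx hy.
case/lastP: l ok => [|l [i x] _]; first by rewrite word_ok_nil.
by rewrite !tractE -cats1 !rscale_cat //= ractA.
Qed.

Fact tract1 x : tract x 1 = x.
Proof.
elim/tensor_sum_ind: x => [|x y hx hy|j l ok] /=.
- by rewrite -(subrr 0) !tractB !subrr.
- by rewrite !tractB hx hy.
case/lastP: l ok => [|l [i x] _]; first by rewrite word_ok_nil.
by rewrite !tractE -cats1 !rscale_cat //= ract1.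
Qed.

Fact tscale_ract s t (x : tensor_sum) : s *: tract x t = tract (s *: x) t.
Proof.
elim/tensor_sum_ind: x => [|x y hx hy|j l ok] /=.
- by rewrite -(subrr 0) !(tractB, scalerBr) !subrr.
- by rewrite !(tractB, scalerBr) hx hy.
rewrite /GRing.scale /= !(tractE, tscaleE).
by case: l {ok} => [|[i x] [|[k y] l]] //=; rewrite scale_ract.
Qed.

HB.instance Definition _ := Lmodule_isBimodule.Build S tensor_sum
  tractDl tractDr tractA tract1 tscale_ract.

Definition tmul (x y : tensor_sum) : tensor_sum :=
  tensor_lift (fun i l =>
    tensor_lift (fun j m => pure (cat_shape i j) (l ++ m)) y) x.

Lemma tmul_multilinearr i l :
  multilinear (fun j m => pure (cat_shape i j) (l ++ m)).
Proof. by split=> *; rewrite !catA (pure_add, pure_balance). Qed.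

Lemma tmul_multilinearl y : multilinear (fun i l =>
  tensor_lift (fun j m => pure (cat_shape i j) (l ++ m)) y).
Proof.
have tB i l := tensor_liftB (tmul_multilinearr i l).
have tE i l j m := tensor_liftE (tmul_multilinearr i l) (j := j) (l := m).
elim/tensor_sum_ind: y => [|x y [x1 x2] [y1 y2]|j m ok].
- have t0 i l : tensor_lift (fun j m => pure (cat_shape i j) (l ++ m)) 0 = 0.
    by rewrite -(subrr 0) tB !subrr.
  by split=> *; rewrite !t0 ?addr0.
- split=> *; rewrite !tB; last by rewrite x2 ?y2.
  by rewrite x1 ?y1 // opprD addrACA.
by split=> *; rewrite !tE // -!catA (pure_add, pure_balance).
Qed.

Lemma tmulE i l j m : word_ok i l -> word_ok j m ->
  tmul (pure i l) (pure j m) = pure (cat_shape i j) (l ++ m).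
Proof.
move=> h k; rewrite /tmul (tensor_liftE (tmul_multilinearl _)) //.
by rewrite (tensor_liftE (tmul_multilinearr _ _)).
Qed.

Lemma tmulBl z : zmod_morphism (tmul^~ z).
Proof. exact: (tensor_liftB (tmul_multilinearl z)). Qed.

Lemma tmulBr z : zmod_morphism (tmul z).
Proof.
elim/tensor_sum_ind: z => [|x y hx hy|i l ok] u v.
- by rewrite -(subrr 0) !tmulBl !subrr.
- by rewrite !tmulBl hx hy !opprD addrACA.
rewrite /tmul !(tensor_liftE (tmul_multilinearl _)) //.
exact: (tensor_liftB (tmul_multilinearr i l)).
Qed.

Lemma tmul0 z : tmul 0 z = 0.
Proof. by rewrite -(subrr 0) tmulBl !subrr. Qed.
Lemma tmulr0 z : tmul z 0 = 0.
Proof. by rewrite -(subrr 0) tmulBr !subrr. Qed.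

Fact tmulDl z x y : tmul (x + y) z = tmul x z + tmul y z.
Proof.
have sN u : tmul (- u) z = - tmul u z by rewrite -sub0r tmulBl tmul0 sub0r.
by rewrite -{1}[y]opprK tmulBl sN opprK.
Qed.

Fact tmulDr z x y : tmul z (x + y) = tmul z x + tmul z y.
Proof.
have sN u : tmul z (- u) = - tmul z u by rewrite -sub0r tmulBr tmulr0 sub0r.
by rewrite -{1}[y]opprK tmulBr sN opprK.
Qed.

Lemma scale_pure s j l : s *: pure j l = pure j (lscale s l).
Proof. exact: tscaleE. Qed.
Lemma ract_pure s j l : ract (pure j l) s = pure j (rscale l s).
Proof. exact: tractE. Qed.

Fact tmul_balanced s x y : tmul (ract x s) y = tmul x (s *: y).
Proof.
elim/tensor_sum_ind: x => [|x1 x2 h1 h2|i l okl].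
- by rewrite ract0l !tmul0.
- by rewrite ractBl !tmulBl h1 h2.
elim/tensor_sum_ind: y => [|y1 y2 h1 h2|j m okm].
- by rewrite scaler0 !tmulr0.
- by rewrite scalerBr !tmulBr h1 h2.
rewrite ract_pure scale_pure !tmulE ?word_ok_lscale ?word_ok_rscale //.
case/lastP: l okl => [|l [k x] _]; first by rewrite word_ok_nil.
case: m okm => [|[k' y] m _]; first by rewrite word_ok_nil.
by rewrite -cats1 rscale_cat //= -!catA /= pure_balance.
Qed.

Fact tmul_scalel s (x y : tensor_sum) : tmul (s *: x) y = s *: tmul x y.
Proof.
elim/tensor_sum_ind: x => [|x1 x2 h1 h2|i l okl].
- by rewrite scaler0 !tmul0 scaler0.
- by rewrite scalerBr !tmulBl h1 h2 scalerBr.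
elim/tensor_sum_ind: y => [|y1 y2 h1 h2|j m okm].
- by rewrite !tmulr0 scaler0.
- by rewrite !tmulBr h1 h2 scalerBr.
rewrite scale_pure !tmulE ?word_ok_lscale // scale_pure.
by case: l okl => [|//]; rewrite word_ok_nil.
Qed.

Fact tmul_ractr s (x y : tensor_sum) : tmul x (ract y s) = ract (tmul x y) s.
Proof.
elim/tensor_sum_ind: x => [|x1 x2 h1 h2|i l okl].
- by rewrite !tmul0 ract0l.
- by rewrite !tmulBl h1 h2 ractBl.
elim/tensor_sum_ind: y => [|y1 y2 h1 h2|j m okm].
- by rewrite ract0l !tmulr0 ract0l.
- by rewrite ractBl !tmulBr h1 h2 ractBl.
rewrite ract_pure !tmulE ?word_ok_rscale // ract_pure.
by rewrite rscale_cat // (word_ok_neq0 okm).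
Qed.

Lemma word_ok_cat i l j m :
  word_ok i l -> word_ok j m -> word_ok (cat_shape i j) (l ++ m).
Proof.
move=> /andP[ai /eqP li] /andP[aj /eqP lj].
by rewrite /word_ok cat_admissible // letters_cat // map_cat li lj eqxx.
Qed.

Fact tmulA x y z : tmul x (tmul y z) = tmul (tmul x y) z.
Proof.
elim/tensor_sum_ind: x => [|x1 x2 h1 h2|i l okl].
- by rewrite !tmul0.
- by rewrite !tmulBl h1 h2.
elim/tensor_sum_ind: y => [|x1 x2 h1 h2|j m okm].
- by rewrite tmulr0 !tmul0 tmulr0.
- by rewrite tmulBl !tmulBr tmulBl h1 h2.
elim/tensor_sum_ind: z => [|x1 x2 h1 h2|k n okn].
- by rewrite !tmulr0.
- by rewrite !tmulBr h1 h2.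
by rewrite !tmulE ?word_ok_cat // cat_shapeA catA.
Qed.

HB.instance Definition _ := Bimodule_isNonUnitalAlgebra.Build S tensor_sum
  tmulDl tmulDr tmul_balanced tmul_scalel tmul_ractr tmulA.

Definition tensor_part (n : nat) (x : tensor_sum) : Prop :=
  span (fun y => exists2 j, degree j = n & exists l, y = pure j l) x.
End TensorSum.

Section Ideals.
Variables (S : pzRingType) (A : nuAlgType S).

Definition ideal_closed (I : {pred A}) : Prop :=
  [/\ zmod_closed I,
      forall s x, x \in I -> s *: x \in I,
      forall s x, x \in I -> ract x s \in I,
      forall a x, x \in I -> amul a x \in I
    & forall a x, x \in I -> amul x a \in I].

Record ideal := Ideal {
  ideal_pred :> {pred A};
  ideal_closedP : ideal_closed ideal_pred;
}.

Variable I : ideal.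

Fact ideal_submod_closed : submod_closed I.
Proof.
case: (ideal_closedP I) => -[I0 IB] IZ _ _ _; split=> // s x y hx hy.
by rewrite -[y]opprK IB ?IZ // -sub0r IB.
Qed.
HB.instance Definition _ :=
  GRing.isSubmodClosed.Build S A (ideal_pred I) ideal_submod_closed.

Definition ideal_module : Type := {x : A | x \in ideal_pred I}.
HB.instance Definition _ := [isSub of ideal_module for @sval A _].
HB.instance Definition _ := [Choice of ideal_module by <:].
HB.instance Definition _ := [SubChoice_isSubLmodule of ideal_module by <:].

Lemma ideal_ract s x : x \in ideal_pred I -> ract x s \in ideal_pred I.
Proof. by case: (ideal_closedP I) => _ _ + _ _; exact. Qed.
Lemma ideal_mull a x : x \in ideal_pred I -> amul a x \in ideal_pred I.
Proof. by case: (ideal_closedP I) => _ _ _ + _; exact. Qed.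
Lemma ideal_mulr a x : x \in ideal_pred I -> amul x a \in ideal_pred I.
Proof. by case: (ideal_closedP I) => _ _ _ _; exact. Qed.

Definition imod_ract (x : ideal_module) s : ideal_module :=
  exist _ (ract (val x) s) (ideal_ract s (valP x)).

Fact imod_ractDl s x y : imod_ract (x + y) s = imod_ract x s + imod_ract y s.
Proof. by apply: val_inj; rewrite /= ractDl. Qed.
Fact imod_ractDr x s t : imod_ract x (s + t) = imod_ract x s + imod_ract x t.
Proof. by apply: val_inj; rewrite /= ractDr. Qed.
Fact imod_ractA x s t : imod_ract (imod_ract x s) t = imod_ract x (s * t).
Proof. by apply: val_inj; rewrite /= ractA. Qed.
Fact imod_ract1 x : imod_ract x 1 = x.
Proof. by apply: val_inj; rewrite /= ract1. Qed.
Fact imod_scale_ract s t (x : ideal_module) :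
  s *: imod_ract x t = imod_ract (s *: x) t.
Proof. by apply: val_inj; rewrite /= scale_ract. Qed.
HB.instance Definition _ := Lmodule_isBimodule.Build S ideal_module
  imod_ractDl imod_ractDr imod_ractA imod_ract1 imod_scale_ract.

(* The two one-sided multiplications A (x) I -> I and I (x) A -> I. *)
Definition imod_mull (a : A) (x : ideal_module) : ideal_module :=
  exist _ (amul a (val x)) (ideal_mull a (valP x)).
Definition imod_mulr (x : ideal_module) (a : A) : ideal_module :=
  exist _ (amul (val x) a) (ideal_mulr a (valP x)).

Local Notation Quot := (Quotient.quot (ideal_pred I)).

Definition quotient_algebra : Type := Quot.
HB.instance Definition _ := GRing.Zmodule.on quotient_algebra.

Definition quotient_map (x : A) : quotient_algebra := \pi_Quot x.
Definition quotient_repr (x : quotient_algebra) : A := repr (x : Quot).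

Lemma quotient_reprK : cancel quotient_repr quotient_map.
Proof. exact: reprK. Qed.

Lemma quotient_mapE x y : (quotient_map x == quotient_map y) = (x - y \in ideal_pred I).
Proof. by rewrite Quotient.idealrBE. Qed.

Lemma quotient_mapB : zmod_morphism quotient_map.
Proof. exact: raddfB. Qed.
HB.instance Definition _ :=
  GRing.isZmodMorphism.Build A quotient_algebra quotient_map quotient_mapB.

Definition qscale s x := quotient_map (s *: quotient_repr x).
Definition qract x s := quotient_map (ract (quotient_repr x) s).
Definition qmul x y := quotient_map (amul (quotient_repr x) (quotient_repr y)).

Lemma quotient_repr_map x : quotient_repr (quotient_map x) - x \in ideal_pred I.
Proof. by rewrite -quotient_mapE quotient_reprK. Qed.

Lemma qscaleE s x : qscale s (quotient_map x) = quotient_map (s *: x).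
Proof.
apply/eqP; rewrite quotient_mapE -scalerBr.
by case: (ideal_closedP I) => _ + _ _ _; apply; exact: quotient_repr_map.
Qed.
Lemma qractE s x : qract (quotient_map x) s = quotient_map (ract x s).
Proof.
by apply/eqP; rewrite quotient_mapE -ractBl ideal_ract // quotient_repr_map.
Qed.
Lemma qmulE x y : qmul (quotient_map x) (quotient_map y) = quotient_map (amul x y).
Proof.
apply/eqP; rewrite quotient_mapE.
set x' := quotient_repr _; set y' := quotient_repr _.
have -> : amul x' y' - amul x y = amul (x' - x) y' + amul x (y' - y).
  by rewrite amulDl amulDr amulNl amulNr addrA subrK.
by apply: rpredD; [apply: ideal_mulr|apply: ideal_mull]; apply: quotient_repr_map.
Qed.

Lemma quotient_ind (P : quotient_algebra -> Prop) :
  (forall x, P (quotient_map x)) -> forall x, P x.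
Proof. by move=> h x; rewrite -[x]quotient_reprK. Qed.

Fact qscaleA s t x : qscale s (qscale t x) = qscale (s * t) x.
Proof. by elim/quotient_ind: x => x; rewrite !qscaleE scalerA. Qed.
Fact qscale1 : left_id 1 qscale.
Proof. by elim/quotient_ind => x; rewrite qscaleE scale1r. Qed.
Fact qscaleDr : right_distributive qscale +%R.
Proof.
move=> s; elim/quotient_ind => x; elim/quotient_ind => y.
by rewrite -raddfD !qscaleE -raddfD scalerDr.
Qed.
Fact qscaleDl x : {morph qscale^~ x : s t / s + t}.
Proof.
by elim/quotient_ind: x => x s t; rewrite !qscaleE -raddfD scalerDl.
Qed.
HB.instance Definition _ := GRing.Zmodule_isLmodule.Build S quotient_algebra
  qscaleA qscale1 qscaleDr qscaleDl.

Fact qractDl s x y : qract (x + y) s = qract x s + qract y s.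
Proof.
elim/quotient_ind: x => x; elim/quotient_ind: y => y.
by rewrite -raddfD !qractE -raddfD ractDl.
Qed.
Fact qractDr x s t : qract x (s + t) = qract x s + qract x t.
Proof. by elim/quotient_ind: x => x; rewrite !qractE -raddfD ractDr. Qed.
Fact qractA x s t : qract (qract x s) t = qract x (s * t).
Proof. by elim/quotient_ind: x => x; rewrite !qractE ractA. Qed.
Fact qract1 x : qract x 1 = x.
Proof. by elim/quotient_ind: x => x; rewrite !qractE ract1. Qed.
Fact qscale_ract s t (x : quotient_algebra) : s *: qract x t = qract (s *: x) t.
Proof.
elim/quotient_ind: x => x.
by rewrite /GRing.scale /= !(qractE, qscaleE) scale_ract.
Qed.
HB.instance Definition _ := Lmodule_isBimodule.Build S quotient_algebra
  qractDl qractDr qractA qract1 qscale_ract.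

Fact qmulDl z x y : qmul (x + y) z = qmul x z + qmul y z.
Proof.
elim/quotient_ind: x => x; elim/quotient_ind: y => y; elim/quotient_ind: z => z.
by rewrite -raddfD !qmulE -raddfD amulDl.
Qed.
Fact qmulDr x y z : qmul x (y + z) = qmul x y + qmul x z.
Proof.
elim/quotient_ind: x => x; elim/quotient_ind: y => y; elim/quotient_ind: z => z.
by rewrite -raddfD !qmulE -raddfD amulDr.
Qed.
Fact qmul_balanced s x y : qmul (ract x s) y = qmul x (s *: y).
Proof.
elim/quotient_ind: x => x; elim/quotient_ind: y => y.
by rewrite /ract /GRing.scale /= qractE qscaleE !qmulE amul_balanced.
Qed.
Fact qmul_scalel s x y : qmul (s *: x) y = s *: qmul x y.
Proof.
elim/quotient_ind: x => x; elim/quotient_ind: y => y.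
by rewrite /GRing.scale /= qscaleE !qmulE qscaleE amul_scalel.
Qed.
Fact qmul_ractr s x y : qmul x (ract y s) = ract (qmul x y) s.
Proof.
elim/quotient_ind: x => x; elim/quotient_ind: y => y.
by rewrite /ract /= qractE !qmulE qractE amul_ractr.
Qed.
Fact qmulA x y z : qmul x (qmul y z) = qmul (qmul x y) z.
Proof.
elim/quotient_ind: x => x; elim/quotient_ind: y => y; elim/quotient_ind: z => z.
by rewrite !qmulE amulA.
Qed.
HB.instance Definition _ := Bimodule_isNonUnitalAlgebra.Build S quotient_algebra
  qmulDl qmulDr qmul_balanced qmul_scalel qmul_ractr qmulA.
End Ideals.

Section DifferentialGraded.
Variable S : pzRingType.

(* The data of a non-negatively graded dg algebra: a total algebra, its
   homogeneous parts and its differential. The axioms are is_dg_algebra. *)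
Record dg_data := DgData {
  dg_total :> nuAlgType S;
  dg_part : nat -> dg_total -> Prop;
  dg_diff : dg_total -> dg_total;
}.

Definition bimodule_morphism (U V : bimodType S) (f : U -> V) : Prop :=
  [/\ zmod_morphism f, forall s x, f (s *: x) = s *: f x
    & forall x s, f (ract x s) = ract (f x) s].

Definition algebra_morphism (A B : nuAlgType S) (f : A -> B) : Prop :=
  bimodule_morphism f /\ forall x y, f (amul x y) = amul (f x) (f y).

Definition sub_bimodule (V : bimodType S) (P : V -> Prop) : Prop :=
  [/\ P 0, forall x y, P x -> P y -> P (x - y), forall s x, P x -> P (s *: x)
    & forall x s, P x -> P (ract x s)].

Definition graded_algebra (A : nuAlgType S) (part : nat -> A -> Prop) : Prop :=
  [/\ forall n, sub_bimodule (part n),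
      forall x, exists n, exists2 c : nat -> A,
        forall i, part i (c i) & x = \sum_(i < n) c i,
      forall n (c : nat -> A), (forall i, part i (c i)) ->
        \sum_(i < n) c i = 0 -> forall i, (i < n)%N -> c i = 0
    & forall m n x y, part m x -> part n y -> part (m + n)%N (amul x y)].

Definition is_dg_algebra (A : dg_data) : Prop :=
  [/\ graded_algebra (@dg_part A),
      bimodule_morphism (@dg_diff A),
      (forall x, dg_part 0 x -> dg_diff x = 0 :> A) /\
      (forall n x, dg_part n.+1 x -> dg_part n (dg_diff x : A)),
      forall x : A, dg_diff (dg_diff x) = 0
    & forall n (x y : A), dg_part n x -> dg_diff (amul x y)
        = amul (dg_diff x) y + (-1) ^+ n *: amul x (dg_diff y)].

Definition dg_morphism (A B : dg_data) (f : A -> B) : Prop :=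
  [/\ algebra_morphism f, forall n x, dg_part n x -> dg_part n (f x)
    & forall x, f (dg_diff x) = dg_diff (f x)].

Definition cycle_of (A : dg_data) n (x : A) : Prop :=
  dg_part n x /\ dg_diff x = 0.

Definition homologous (A : dg_data) n (x y : A) : Prop :=
  exists2 z, dg_part n.+1 z & x - y = dg_diff z.

(* H_n is the group of n-cycles modulo "homologous"; the two conditions are
   injectivity and surjectivity of H_n(f), written on representatives. *)
Definition quasi_isomorphism (A B : dg_data) (f : A -> B) : Prop :=
  forall n,
    (forall x y, cycle_of n x -> cycle_of n y ->
       homologous n (f x) (f y) -> homologous n x y) /\
    (forall z, cycle_of n z -> exists2 x, cycle_of n x & homologous n (f x) z).

Inductive quasi_isomorphic : dg_data -> dg_data -> Prop :=
| qis_map (A B : dg_data) (f : A -> B) : is_dg_algebra A -> is_dg_algebra B ->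
    dg_morphism f -> quasi_isomorphism f -> quasi_isomorphic A B
| qis_sym A B : quasi_isomorphic A B -> quasi_isomorphic B A
| qis_trans A B C :
    quasi_isomorphic A B -> quasi_isomorphic B C -> quasi_isomorphic A C.

Definition concentrated (A : nuAlgType S) : dg_data :=
  @DgData A (fun n x => n = 0%N \/ x = 0) (fun=> 0).
End DifferentialGraded.

Section TensorAlgebras.
Variable S : pzRingType.

Fact power_neq0 n : (0 < n)%N -> nseq n tt != [::]. Proof. by case: n. Qed.
Fact power_cat m n : (0 < m)%N -> (0 < n)%N -> (0 < m + n)%N.
Proof. by case: m. Qed.
Fact power_letters m n : (0 < m)%N -> (0 < n)%N ->
  nseq (m + n) tt = nseq m tt ++ nseq n tt.
Proof. by move=> _ _; rewrite nseqD. Qed.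
Definition powers : shapes unit :=
  @Shapes unit nat (fun n => 0 < n)%N (fun n => nseq n tt) addn (fun=> 0%N)
    power_neq0 power_cat power_letters (fun _ _ _ _ => erefl) addnA.

(* T^+_S(V): the sum of the tensor powers V^n over n >= 1. *)
Definition tensor_algebra (V : bimodType S) : nuAlgType S :=
  tensor_sum (fun _ : unit => V) powers.

Fact words_cat (u v : seq nat) : u != [::] -> v != [::] -> u ++ v != [::].
Proof. by case: u. Qed.
Definition words : shapes nat :=
  @Shapes nat (seq nat) (fun u => u != [::]) id cat sumn
    (fun _ h => h) words_cat (fun _ _ _ _ => erefl)
    (fun u v _ _ => sumn_cat u v) (@catA nat).

(* T^+_S(W) for a graded bimodule W: the sum of the W_(n_1) (x) ... (x) W_(n_k)
   over k >= 1, of degree n_1 + ... + n_k. *)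
Definition graded_tensor_algebra (W : nat -> bimodType S) : nuAlgType S :=
  tensor_sum W words.

Definition graded_isomorphism (A B : nuAlgType S)
    (partA : nat -> A -> Prop) (partB : nat -> B -> Prop) (f : A -> B) : Prop :=
  [/\ bijective f, algebra_morphism f & forall n x, partA n x <-> partB n (f x)].

Definition free_resolution (R : dg_data S) (A : nuAlgType S) : Prop :=
  [/\ is_dg_algebra R, quasi_isomorphic R (concentrated A)
    & exists (W : nat -> bimodType S) (f : R -> graded_tensor_algebra W),
        graded_isomorphism (@dg_part S R) (@tensor_part S nat W words) f].
End TensorAlgebras.

(* Star is the innermost bracket [*], a single symbol of the words. *)
Inductive token := Input | Star | LeftBracket | RightBracket.

Definition token_code (t : token) : bool * bool :=
  match t with
  | Input => (false, false) | Star => (false, true)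
  | LeftBracket => (true, false) | RightBracket => (true, true)
  end.
Definition token_decode (c : bool * bool) : token :=
  match c with
  | (false, false) => Input | (false, true) => Star
  | (true, false) => LeftBracket | (true, true) => RightBracket
  end.
Fact token_codeK : cancel token_code token_decode. Proof. by case. Qed.
HB.instance Definition _ := Countable.copy token (can_type token_codeK).

(* Left brackets; [*] carries one, so a word has (count opens) bracket pairs. *)
Definition opens (t : token) : bool := (t == LeftBracket) || (t == Star).

(* The boolean index of bracketing_ tells whether the word is closed, i.e. is
   [*] or [u] for a bracketing u; bracketingP is the unindexed form. *)
Inductive bracketing_ : bool -> seq token -> Prop :=
| bracketing_input : bracketing_ false [:: Input]
| bracketing_star : bracketing_ true [:: Star]
| bracketing_wrap u : bracketing_ false u -> has opens u ->
    bracketing_ true (LeftBracket :: rcons u RightBracket)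
| bracketing_cat b c u v :
    bracketing_ b u -> bracketing_ c v -> bracketing_ false (u ++ v).

Definition bracketing (u : seq token) : Prop := exists b, bracketing_ b u.

Definition closed_word (w : seq token) : Prop :=
  w = [:: Star] \/
  exists2 u, bracketing u & w = LeftBracket :: rcons u RightBracket.

Lemma bracketing_balanced b w : bracketing_ b w ->
  (forall n, count_mem RightBracket (take n w)
             <= count_mem LeftBracket (take n w))%N /\
  count_mem RightBracket w = count_mem LeftBracket w.
Proof.
elim=> {b w} [||u _ [hu eu] _|b c u v _ [hu eu] _ [hv ev]].
- by split=> // -[|[|n]].
- by split=> // -[|[|n]].
- split=> [[|n] //=|]; last first.
    by rewrite /= -cats1 !count_cat /= eu !addn0 add0n addnC.
  rewrite /= add0n -cats1 take_cat; case: ltnP => _.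
    exact: leq_trans (hu n) (leq_addl _ _).
  rewrite !count_cat eu [leqRHS]addnCA leq_add2l.
  by case: (n - _)%N => [|[|m]].
- split=> [n|]; last by rewrite !count_cat eu ev.
  rewrite take_cat; case: ltnP => _ //; rewrite !count_cat eu leq_add2l //.
Qed.

Lemma bracketing_neq0 b w : bracketing_ b w -> w != [::].
Proof. by elim=> {b w} [||u|b c u v _ un0 _ _] //; case: u un0. Qed.

Lemma wrap_not_cat u v w b c d : bracketing_ b u -> bracketing_ c v ->
  bracketing_ d w -> LeftBracket :: rcons w RightBracket <> u ++ v.
Proof.
move=> hu hv hw; case: u hu => [/bracketing_neq0 //|t u] hu.
case/lastP: v hv => [/bracketing_neq0 //|v r] hv.
rewrite cat_cons -rcons_cat => -[] et /rcons_inj[ew er].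
have [_] := bracketing_balanced hu; have [+ _] := bracketing_balanced hw.
move=> /(_ (size u)); rewrite ew take_size_cat // -et /= add0n add1n => h.
by move=> e; move: h; rewrite e ltnn.
Qed.

Lemma bracketing_closed b w : bracketing_ b w -> b <-> closed_word w.
Proof.
elim=> {b w} [||u hu _ _|b c u v hu _ hv _]; split=> //.
- by case=> // -[u _]; case: u.
- by left.
- by right; exists u => //; exists false.
- case=> [|[w [d hw] e]]; last by case: (wrap_not_cat hu hv hw).
  move: (bracketing_neq0 hu) (bracketing_neq0 hv).
  by case: u {hu} => [|? [|? ?]] //; case: v {hv}.
Qed.

Lemma bracketingP w : bracketing w <->
  [\/ w = [:: Input], w = [:: Star],
      exists u, [/\ bracketing u, has opens u, ~ closed_word u
                  & w = LeftBracket :: rcons u RightBracket]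
    | exists u v, [/\ bracketing u, bracketing v & w = u ++ v]].
Proof.
split=> [[b hw]|[->|->|[u [[b hu] ou cu ->]]|[u [v [[b hu] [c hv] ->]]]]].
- case: hw => [||u hu ou|{}b c u v hu hv].
  + by constructor 1.
  + by constructor 2.
  + constructor 3; exists u; split=> //; first by exists false.
    by move/(bracketing_closed hu).
  + by constructor 4; exists u, v; split=> //; [exists b|exists c].
- by exists false; constructor.
- by exists true; constructor.
- exists true; constructor=> //; case: b hu => // hu.
  by case: cu; apply/(bracketing_closed hu).
- by exists false; apply: bracketing_cat hu hv.
Qed.

(* The letters of a bracketing: false for a copy of V, true for a copy of I. *)
Definition bracket_letters (w : seq token) : seq bool :=
  pmap (fun t => match t with Input => Some false | Star => Some true | _ => None end) w.

Fact bracket_letters_neq0 w : `[< bracketing w >] -> bracket_letters w != [::].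
Proof.
rewrite /bracket_letters => /asboolP[b].
elim=> {b w} [||u _ hu _|b c u v _ hu _ hv] //.
  by rewrite /= -cats1 pmap_cat; case: (pmap _ u) hu.
by rewrite pmap_cat; case: (pmap _ u) hu.
Qed.
Fact bracket_cat u v :
  `[< bracketing u >] -> `[< bracketing v >] -> `[< bracketing (u ++ v) >].
Proof.
by move=> /asboolP[b hu] /asboolP[c hv]; apply/asboolP; exists false;
  apply: bracketing_cat hu hv.
Qed.
Definition bracketings : shapes bool :=
  @Shapes bool (seq token) (fun w => `[< bracketing w >]) bracket_letters cat
    (count opens) bracket_letters_neq0 bracket_cat
    (fun u v _ _ => pmap_cat _ u v) (fun u v _ _ => count_cat _ u v)
    (@catA token).

(* Deletes the right bracket matching a left bracket that immediately precedes
   w; k is the number of further brackets currently open. *)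
Fixpoint drop_match (k : nat) (w : seq token) : seq token :=
  match w with
  | [::] => [::]
  | RightBracket :: w' =>
      if k is k'.+1 then RightBracket :: drop_match k' w' else w'
  | LeftBracket :: w' => LeftBracket :: drop_match k.+1 w'
  | t :: w' => t :: drop_match k w'
  end.

Section BracketResolution.
Variables (S : pzRingType) (V : bimodType S) (I : ideal (tensor_algebra V)).

Definition bracket_module (k : bool) : bimodType S :=
  if k then (ideal_module I : bimodType S) else V.

Local Notation Vletter := (letter (fun _ : unit => V)).
Local Notation Bletter := (letter bracket_module).
Local Notation Vl := (mkletter (M := fun _ : unit => V) (i := tt)).
Local Notation Bl := (mkletter (M := bracket_module)).

Definition bracket_algebra : nuAlgType S := tensor_sum bracket_module bracketings.

Definition tensor1 (v : V) : tensor_algebra V :=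
  pure (X := powers) 1%N [:: Vl v].

Definition of_Vletter (x : Vletter) : Bletter :=
  Bl (i := false) (tagged x).

Definition to_V (x : Bletter) : V :=
  match x with existT false v => v | existT true _ => 0 end.
Definition to_I (x : Bletter) : ideal_module I :=
  match x with existT true i => i | existT false _ => 0 end.

(* The multiplication map V^a (x) I (x) V^b -> I on pure tensors. *)
Definition absorb (l1 : seq Bletter) (i : ideal_module I) (l2 : seq Bletter) :
    ideal_module I :=
  foldl (fun y x => imod_mulr y (tensor1 (to_V x)))
    (foldr (fun x y => imod_mull (tensor1 (to_V x)) y) i l1) l2.

(* Removal of the pair opened by the token of w in position p, on the pure
   tensor l of the summand w. When this token is a [*], the letters l1 and l2
   stand before and after the letter i of that [*], and a and b are the lengths
   of the runs of inputs adjacent to it; the first branch is the case where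
   these runs are enclosed in a matching pair of brackets. *)
Definition remove_pair (w : seq token) (l : seq Bletter) (p : nat) :
    bracket_algebra :=
  let w1 := take p w in
  let w2 := drop p.+1 w in
  if nth Input w p == LeftBracket then pure (X := bracketings) (w1 ++ drop_match 0 w2) l
  else
    let k := size (bracket_letters w1) in
    let l1 := take k l in
    let l2 := drop k.+1 l in
    let i := to_I (nth (Bl (i := true) 0) l k) in
    let a := find (predC1 Input) (rev w1) in
    let b := find (predC1 Input) w2 in
    if (nth Input (rev w1) a == LeftBracket) && (nth Input w2 b == RightBracket)
    then pure (X := bracketings) (take (p - a.+1) w1 ++ Star :: drop b.+1 w2)
           (take (k - a) l1
            ++ Bl (i := true)
                 (absorb (drop (k - a) l1) i (take b l2))
            :: drop b l2)
    else tensor_lift (fun (j : powers) (m : seq Vletter) => pure (X := bracketings) (w1 ++ nseq j Input ++ w2)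
                                   (l1 ++ map of_Vletter m ++ l2))
           (val i : tensor_algebra V).

(* The m-th left bracket sits in position p with m - 1 left brackets before. *)
Definition bracket_diff : bracket_algebra -> bracket_algebra :=
  tensor_lift (fun (w : bracketings) l =>
    \sum_(p < size w | opens (nth Input w p))
       (-1) ^+ count opens (take p w) *: remove_pair w l p).

Definition bracket_resolution : dg_data S :=
  @DgData S bracket_algebra (@tensor_part S bool bracket_module bracketings)
    bracket_diff.

(* In degree 0 the words are the runs of n inputs, identified with V^n. *)
Definition augmentation : bracket_resolution -> concentrated (quotient_algebra I) :=
  tensor_lift (fun (w : bracketings) l =>
    if all (pred1 Input) w
    then quotient_map I (pure (X := powers) (size w)
           [seq Vl (to_V x) | x <- l])
    else 0).
End BracketResolution.

Section WellDefined.
Variables (S : pzRingType) (V : bimodType S) (I : ideal (tensor_algebra V)).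
Local Notation Vletter := (letter (fun _ : unit => V)).
Local Notation Bletter := (letter (bracket_module I)).
Local Notation Vl := (mkletter (M := fun _ : unit => V) (i := tt)).
Local Notation Bl := (mkletter (M := bracket_module I)).
Implicit Types (l m : seq Bletter) (s : S).

Definition slotwise (A : zmodType) (g : seq Bletter -> A) : Prop :=
  (forall l m k (x y : bracket_module I k), g (l ++ Bl (x + y) :: m)
     = g (l ++ Bl x :: m) + g (l ++ Bl y :: m)) /\
  (forall l m k k' (x : bracket_module I k) s (y : bracket_module I k'),
     g (l ++ Bl (ract x s) :: Bl y :: m) = g (l ++ Bl x :: Bl (s *: y) :: m)).

Lemma slotwise_split (A : zmodType) n (f : seq Bletter -> seq Bletter -> A) :
  (forall m, slotwise (f^~ m)) -> (forall l, slotwise (f l)) ->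
  (forall l m k k' (x : bracket_module I k) s (y : bracket_module I k'),
     f (l ++ [:: Bl (ract x s)]) (Bl y :: m)
     = f (l ++ [:: Bl x]) (Bl (s *: y) :: m)) ->
  slotwise (fun l => f (take n l) (drop n l)).
Proof.
move=> f1 f2 f12; split=> [l m k x y|l m k k' x s y]; rewrite !take_cat !drop_cat.
  case: ltnP => _; first by case: (f2 (take n l)) => ->.
  case: (n - _)%N => [|d] /=; last by case: (f1 (drop d m)) => ->.
  by rewrite cats0; case: (f2 l) => /(_ [::]) /= ->.
case: ltnP => _; first by case: (f2 (take n l)) => _ ->.
case: (n - _)%N => [|[|d]] /=.
- by rewrite cats0; case: (f2 l) => _ /(_ [::]) /= ->.
- by rewrite ?take0 ?drop0 f12.
- by case: (f1 (drop d m)) => _ ->.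
Qed.

Lemma slotwise_pure w : slotwise (pure (X := bracketings) (M := bracket_module I) w).
Proof. by split=> *; [exact: pure_add|exact: pure_balance]. Qed.

Lemma tensor1D : {morph @tensor1 S V : x y / x + y}.
Proof. by move=> x y; rewrite /tensor1 (pure_add _ [::]). Qed.
Lemma tensor1_scale s x : tensor1 (s *: x) = s *: tensor1 x :> tensor_algebra V.
Proof. by rewrite /tensor1 scale_pure. Qed.
Lemma tensor1_ract s x : tensor1 (ract x s) = ract (tensor1 x) s :> tensor_algebra V.
Proof. by rewrite /tensor1 ract_pure. Qed.

Local Arguments to_V : simpl never.
Local Arguments to_I : simpl never.

Lemma to_VD k (x y : bracket_module I k) :
  to_V (Bl (x + y)) = to_V (Bl x) + to_V (Bl y).
Proof. by case: k x y => x y; rewrite /to_V /to_I /= ?addr0. Qed.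
Lemma to_V_scale k s (x : bracket_module I k) : to_V (Bl (s *: x)) = s *: to_V (Bl x).
Proof. by case: k x => x; rewrite /to_V /to_I /= ?scaler0. Qed.
Lemma to_V_ract k s (x : bracket_module I k) :
  to_V (Bl (ract x s)) = ract (to_V (Bl x)) s.
Proof. by case: k x => x; rewrite /to_V /to_I /= ?ract0l. Qed.
Lemma to_ID k (x y : bracket_module I k) :
  to_I (Bl (x + y)) = to_I (Bl x) + to_I (Bl y).
Proof. by case: k x y => x y; rewrite /to_V /to_I /= ?addr0. Qed.
Lemma to_I_scale k s (x : bracket_module I k) : to_I (Bl (s *: x)) = s *: to_I (Bl x).
Proof. by case: k x => x; rewrite /to_V /to_I /= ?scaler0. Qed.
Lemma to_I_ract k s (x : bracket_module I k) :
  to_I (Bl (ract x s)) = ract (to_I (Bl x)) s.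
Proof. by case: k x => x; rewrite /to_V /to_I /= ?ract0l. Qed.

Local Notation absl l i := (foldr (fun x y => imod_mull (tensor1 (to_V x)) y) i l).
Local Notation absr i l := (foldl (fun y x => imod_mulr y (tensor1 (to_V x))) i l).

Implicit Types i j : ideal_module I.

Lemma imod_mullDr a i j : imod_mull a (i + j) = imod_mull a i + imod_mull a j.
Proof. by apply: val_inj; rewrite /= amulDr. Qed.
Lemma imod_mullDl a b i : imod_mull (a + b) i = imod_mull a i + imod_mull b i.
Proof. by apply: val_inj; rewrite /= amulDl. Qed.
Lemma imod_mulrDr a b i : imod_mulr i (a + b) = imod_mulr i a + imod_mulr i b.
Proof. by apply: val_inj; rewrite /= amulDr. Qed.
Lemma imod_mulrDl a i j : imod_mulr (i + j) a = imod_mulr i a + imod_mulr j a.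
Proof. by apply: val_inj; rewrite /= amulDl. Qed.
Lemma imod_mull_scale s a i : imod_mull (s *: a) i = s *: imod_mull a i.
Proof. by apply: val_inj; rewrite /= amul_scalel. Qed.
Lemma imod_mulr_scale s a i : imod_mulr (s *: i) a = s *: imod_mulr i a.
Proof. by apply: val_inj; rewrite /= amul_scalel. Qed.
Lemma imod_mull_ract s a i : imod_mull a (ract i s) = ract (imod_mull a i) s.
Proof. by apply: val_inj; rewrite /= amul_ractr. Qed.
Lemma imod_mulr_ract s a i : imod_mulr i (ract a s) = ract (imod_mulr i a) s.
Proof. by apply: val_inj; rewrite /= amul_ractr. Qed.
Lemma imod_mull_balanced s a i : imod_mull (ract a s) i = imod_mull a (s *: i).
Proof. by apply: val_inj; rewrite /= amul_balanced. Qed.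
Lemma imod_mulr_balanced s a i : imod_mulr (ract i s) a = imod_mulr i (s *: a).
Proof. by apply: val_inj; rewrite /= amul_balanced. Qed.

Lemma abslD l i j : absl l (i + j) = absl l i + absl l j.
Proof. by elim: l => //= x l ->; rewrite imod_mullDr. Qed.
Lemma absrD l i j : absr (i + j) l = absr i l + absr j l.
Proof. by elim: l i j => //= x l IHl i j; rewrite imod_mulrDl IHl. Qed.
Lemma absl_ract l i s : absl l (ract i s) = ract (absl l i) s.
Proof. by elim: l => //= x l ->; rewrite imod_mull_ract. Qed.
Lemma absr_scale l i s : absr (s *: i) l = s *: absr i l.
Proof. by elim: l i => //= x l IHl i; rewrite imod_mulr_scale IHl. Qed.

Lemma slotwise_absorbl i m : slotwise (fun l => absorb l i m).
Proof.
rewrite /absorb; split=> [l1 l2 k x y|l1 l2 k k' x s y]; rewrite !foldr_cat /=.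
  by rewrite to_VD tensor1D imod_mullDl abslD absrD.
by rewrite to_V_ract to_V_scale tensor1_ract tensor1_scale imod_mull_balanced
  imod_mull_scale.
Qed.

Lemma slotwise_absorbr i l : slotwise (fun m => absorb l i m).
Proof.
rewrite /absorb; split=> [l1 l2 k x y|l1 l2 k k' x s y]; rewrite !foldl_cat /=.
  by rewrite to_VD tensor1D imod_mulrDr absrD.
by rewrite to_V_ract to_V_scale tensor1_ract tensor1_scale imod_mulr_ract
  imod_mulr_balanced.
Qed.

Lemma slotwise_collapse w n b i m : slotwise (fun l =>
  pure (X := bracketings) w (take n l ++ Bl (i := true)
    (absorb (drop n l) i (take b m)) :: drop b m) : bracket_algebra I).
Proof.
pose f l l' : bracket_algebra I := pure (X := bracketings) w
  (l ++ Bl (i := true) (absorb l' i (take b m)) :: drop b m).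
apply: (@slotwise_split _ n f) => [l'|l|l l' k k' x s y]; rewrite /f.
- by split=> *; rewrite -!catA !cat_cons (pure_add, pure_balance).
- have [hD hB] := slotwise_absorbl i (take b m).
  by split=> [l1 l2 k x y|l1 l2 k k' x s y]; rewrite ?hD ?pure_add // hB.
- rewrite -!catA /= pure_balance; congr (pure _ (_ ++ _ :: Bl _ :: _)).
  by rewrite /absorb /= to_V_scale tensor1_scale imod_mull_scale absr_scale.
Qed.

Lemma slotwise_collapser w n b i l : slotwise (fun m =>
  pure (X := bracketings) w (take n l ++ Bl (i := true)
    (absorb (drop n l) i (take b m)) :: drop b m) : bracket_algebra I).
Proof.
pose f m m' : bracket_algebra I := pure (X := bracketings) w
  (take n l ++ Bl (i := true) (absorb (drop n l) i m) :: m').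
apply: (@slotwise_split _ b f) => [m'|m|m m' k k' x s y]; rewrite /f.
- have [hD hB] := slotwise_absorbr i (drop n l).
  by split=> [l1 l2 k x y|l1 l2 k k' x s y]; rewrite ?hD ?pure_add // hB.
- by split=> *; rewrite -!cat_cons !catA (pure_add, pure_balance).
- rewrite -pure_balance; congr (pure _ (_ ++ Bl _ :: _)).
  by rewrite /absorb !foldl_cat /= to_V_ract tensor1_ract imod_mulr_ract.
Qed.

Definition expand w1 w2 l m : tensor_algebra V -> bracket_algebra I :=
  tensor_lift (fun (j : powers) (n : seq Vletter) =>
    pure (X := bracketings) (w1 ++ nseq j Input ++ w2)
      (l ++ map (@of_Vletter S V I) n ++ m)).

Lemma expand_multilinear w1 w2 l m : multilinear (A := bracket_algebra I)
  (fun (j : powers) (n : seq Vletter) =>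
    pure (X := bracketings) (w1 ++ nseq j Input ++ w2)
      (l ++ map (@of_Vletter S V I) n ++ m)).
Proof.
split=> [j n1 n2 i x y _|j n1 n2 i k x s y _];
  rewrite !map_cat /= -!catA !cat_cons !(catA l).
- exact: (pure_add _ _ _ (i := false : bool)).
- exact: (pure_balance _ _ _ (i := false : bool) (k := false : bool)).
Qed.

Lemma expandE w1 w2 l m (j : powers) (n : seq Vletter) : word_ok j n ->
  expand w1 w2 l m (pure (X := powers) j n) =
  pure (X := bracketings) (w1 ++ nseq j Input ++ w2)
      (l ++ map (@of_Vletter S V I) n ++ m).
Proof. exact: (tensor_liftE (expand_multilinear w1 w2 l m)). Qed.

Lemma expandB w1 w2 l m : zmod_morphism (expand w1 w2 l m).
Proof. exact: (tensor_liftB (expand_multilinear w1 w2 l m)). Qed.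

Lemma expand0 w1 w2 l m : expand w1 w2 l m 0 = 0.
Proof. by rewrite -(subrr 0) expandB subrr. Qed.

Lemma expandD w1 w2 l m : {morph expand w1 w2 l m : x y / x + y}.
Proof.
have sN u : expand w1 w2 l m (- u) = - expand w1 w2 l m u.
  by rewrite -sub0r expandB expand0 sub0r.
by move=> x y; rewrite -{1}[y]opprK expandB sN opprK.
Qed.

Lemma slotwise_expandl w1 w2 m t : slotwise (fun l => expand w1 w2 l m t).
Proof.
elim/tensor_sum_ind: t => [|x y [x1 x2] [y1 y2]|j n ok].
- by split=> *; rewrite !expand0 ?addr0.
- by split=> *; rewrite !expandB ?x1 ?y1 ?x2 ?y2 // opprD addrACA.
- by split=> *; rewrite !expandE // -!catA !cat_cons (pure_add, pure_balance).
Qed.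

Lemma slotwise_expandr w1 w2 l t : slotwise (fun m => expand w1 w2 l m t).
Proof.
elim/tensor_sum_ind: t => [|x y [x1 x2] [y1 y2]|j n ok].
- by split=> *; rewrite !expand0 ?addr0.
- by split=> *; rewrite !expandB ?x1 ?y1 ?x2 ?y2 // opprD addrACA.
- by split=> *; rewrite !expandE // !catA (pure_add, pure_balance).
Qed.

Lemma expand_balancel w1 w2 l m t k (x : bracket_module I k) s :
  expand w1 w2 (l ++ [:: Bl (ract x s)]) m t
  = expand w1 w2 (l ++ [:: Bl x]) m (s *: t).
Proof.
elim/tensor_sum_ind: t => [|t u ht hu|j n ok].
- by rewrite scaler0 !expand0.
- by rewrite scalerBr !expandB ht hu.
rewrite scale_pure !expandE ?word_ok_lscale //.
case: n ok => [|[[] v] n] ok; first by rewrite word_ok_nil in ok *.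
by rewrite -!catA /= (pure_balance _ _ _ (k := false : bool)).
Qed.

Lemma expand_balancer w1 w2 l m t k (x : bracket_module I k) s :
  expand w1 w2 l (Bl x :: m) (ract t s) = expand w1 w2 l (Bl (s *: x) :: m) t.
Proof.
elim/tensor_sum_ind: t => [|t u ht hu|j n ok].
- by rewrite ract0l !expand0.
- by rewrite ractBl !expandB ht hu.
rewrite ract_pure !expandE ?word_ok_rscale //.
case/lastP: n ok => [|n [[] v]] ok; first by move: ok; rewrite word_ok_nil.
rewrite -cats1 rscale_cat //= !map_cat /= -!catA /= !(catA l).
exact: (pure_balance _ _ _ (i := false : bool)).
Qed.

Lemma eq_slotwise (A : zmodType) (f g : seq Bletter -> A) :
  f =1 g -> slotwise f -> slotwise g.
Proof. by move=> e [fD fB]; split=> *; rewrite -!e. Qed.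

Lemma slotwise_remove_pair w p :
  slotwise (fun l => remove_pair w l p : bracket_algebra I).
Proof.
rewrite /remove_pair; case: (nth Input w p == LeftBracket) => /=.
  exact: slotwise_pure.
set w1 := take p w; set w2 := drop p.+1 w; set k := size (bracket_letters w1).
set a := find (predC1 Input) (rev w1); set b := find (predC1 Input) w2.
pose i0 := Bl (i := true) 0.
have nE l : nth i0 l k = head i0 (drop k l) by rewrite -nth0 nth_drop addn0.
have dE l : drop k.+1 l = behead (drop k l) by rewrite -drop1 drop_drop add1n.
case: (_ && _).
- set w' := take (p - a.+1) w1 ++ Star :: drop b.+1 w2.
  pose f l r : bracket_algebra I :=
    pure (X := bracketings) w' (take (k - a) l ++ Bl (i := true)
      (absorb (drop (k - a) l) (to_I (head i0 r)) (take b (behead r)))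
      :: drop b (behead r)).
  apply: (@eq_slotwise _ (fun l => f (take k l) (drop k l))) => [l|].
    by rewrite /f nE dE take_takel // leq_subr.
  apply: slotwise_split => [m|l|l m c c' x s y]; rewrite /f {f};
    clearbody w' b.
  + exact: slotwise_collapse.
  + split=> [[|z l1] l2 c x y|[|z l1] l2 c c' x s y] /=.
    * rewrite to_ID /absorb abslD absrD; exact: pure_add.
    * by case: (slotwise_collapser w' (k - a) b (to_I z) l) => ->.
    * case: b => [|b'] /=.
        rewrite ?take0 to_I_ract /absorb /= absl_ract; exact: pure_balance.
      by rewrite /absorb /= to_I_ract to_V_scale tensor1_scale absl_ract
        imod_mulr_balanced.
    * by case: (slotwise_collapser w' (k - a) b (to_I z) l) => _ ->.
  + rewrite /= !take_cat !drop_cat; case: ltnP => _.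
      rewrite /absorb !foldr_cat /= to_V_ract tensor1_ract to_I_scale.
      by rewrite imod_mull_balanced.
    case: (_ - size l)%N => [|n] /=.
      rewrite /absorb /= to_V_ract tensor1_ract to_I_scale.
      by rewrite imod_mull_balanced.
    rewrite -!catA /= pure_balance /absorb /= -absr_scale to_I_scale.
    by [].
pose f l r : bracket_algebra I :=
  expand w1 w2 l (behead r) (val (to_I (head i0 r))).
apply: (@eq_slotwise _ (fun l => f (take k l) (drop k l))) => [l|].
  by rewrite /f nE dE.
apply: slotwise_split => [m|l|l m c c' x s y]; rewrite /f.
- exact: slotwise_expandl.
- split=> [[|z l1] l2 c x y|[|z l1] l2 c c' x s y] /=.
  + by rewrite to_ID; exact: expandD.
  + by case: (slotwise_expandr w1 w2 l (val (to_I z))) => ->.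
  + by rewrite to_I_ract expand_balancer.
  + by case: (slotwise_expandr w1 w2 l (val (to_I z))) => _ ->.
- by rewrite /= expand_balancel to_I_scale.
Qed.

Lemma bracket_diff_multilinear : multilinear (A := bracket_algebra I)
  (fun (w : bracketings) l => \sum_(p < size w | opens (nth Input w p))
       (-1) ^+ count opens (take p w) *: (remove_pair w l p : bracket_algebra I)).
Proof.
split=> [w l m k x y _|w l m k k' x s y _].
  rewrite -big_split; apply: eq_bigr => p _ /=.
  by case: (slotwise_remove_pair w p) => -> _; rewrite scalerDr.
by apply: eq_bigr => p _; case: (slotwise_remove_pair w p) => _ ->.
Qed.

Lemma bracket_diffE (w : bracketings) l : word_ok w l ->
  bracket_diff (pure w l : bracket_algebra I)
  = \sum_(p < size w | opens (nth Input w p))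
       (-1) ^+ count opens (take p w) *: remove_pair w l p.
Proof. exact: (tensor_liftE bracket_diff_multilinear). Qed.

Lemma augmentation_multilinear : multilinear (A := quotient_algebra I)
  (fun (w : bracketings) l =>
    if all (pred1 Input) w
    then quotient_map I (pure (X := powers) (size w)
           [seq Vl (to_V x) | x : Bletter <- l])
    else 0).
Proof.
split=> [w l m k x y _|w l m k k' x s y _]; case: ifP => _; rewrite ?addr0 //.
  by rewrite -raddfD !map_cat /= to_VD pure_add.
by rewrite !map_cat /= to_V_ract to_V_scale pure_balance.
Qed.

Lemma augmentationE (w : bracketings) l : word_ok w l ->
  augmentation (pure w l : bracket_algebra I)
  = if all (pred1 Input) w
    then quotient_map I (pure (X := powers) (size w)
           [seq Vl (to_V x) | x : Bletter <- l])
    else 0 :> quotient_algebra I.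
Proof. exact: (tensor_liftE augmentation_multilinear). Qed.
End WellDefined.

(* Main.v *)
Require Import Defs.
From HB Require Import structures.
From mathcomp Require Import all_boot all_algebra.
From mathcomp Require Import boolp freeg.
From mathcomp Require Import zify.

(** Enclosing a whole bracketing in one more pair of brackets gives a map [h] with
    [d (h x) + h (d x) = x], because the new pair is opened first and so comes
    with sign [+] while shifting the signs of all the others. Two boundary effects
    must be matched. A closed bracketing may not be enclosed again, but then
    [h x = 0] and [h (d x) = x], since the first term of [d x] strips the outer
    pair and the others stay closed. Around a bracketing with a single pair, the
    new pair absorbs its inputs instead of surviving, which amounts to extending
    [h] by the tautological map from [I] to the summand of the bracketing [*].
    So [h] contracts the positive part of the complex and exhibits [I] as the image
    of [d] in degree 0.

    Every bracketing factors uniquely into inputs and closed bracketings, so the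
    algebra is free on the summands of these. The remaining axioms ([d] squares to
    zero and is a bimodule map) follow by induction on this factorization, the
    homotopy formula itself giving the step from a bracketing to the enclosed one. *)

Set Implicit Arguments.
Unset Strict Implicit.
Unset Printing Implicit Defensive.

Import GRing.Theory.
Local Open Scope ring_scope.

Local Notation inputs := (all (pred1 Input)).

Definition lefts (w : seq token) := count_mem LeftBracket w.
Definition rights (w : seq token) := count_mem RightBracket w.

Arguments lefts : simpl never.
Arguments rights : simpl never.

Lemma lefts_cons t w : lefts (t :: w) = ((t == LeftBracket) + lefts w)%N.
Proof. by []. Qed.
Lemma rights_cons t w : rights (t :: w) = ((t == RightBracket) + rights w)%N.
Proof. by []. Qed.
Lemma lefts_cat u v : lefts (u ++ v) = (lefts u + lefts v)%N.
Proof. exact: count_cat. Qed.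
Lemma rights_cat u v : rights (u ++ v) = (rights u + rights v)%N.
Proof. exact: count_cat. Qed.
Definition countE := (lefts_cons, rights_cons, lefts_cat, rights_cat).

Lemma cat_eq_cat_cons (T : Type) (u v w1 w2 : seq T) t :
  u ++ v = w1 ++ t :: w2 ->
  (exists2 u2, u = w1 ++ t :: u2 & w2 = u2 ++ v) \/
  (exists2 v1, w1 = u ++ v1 & v = v1 ++ t :: w2).
Proof.
elim: u w1 => [|x u IHu] [|y w1] /=; [by right; exists [::]|by right; exists (y :: w1)| |].
  by case=> -> e; left; exists u.
by case=> -> /IHu[[u2 -> ->]|[v1 -> ->]]; [left; exists u2|right; exists v1].
Qed.

Lemma wrap_eq_cat_cons (w1 w2 u : seq token) t : t != RightBracket ->
  LeftBracket :: rcons u RightBracket = w1 ++ t :: w2 ->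
  [/\ w1 = [::], t = LeftBracket & w2 = rcons u RightBracket] \/
  exists v1 v2, [/\ w1 = LeftBracket :: v1, w2 = rcons v2 RightBracket
    & u = v1 ++ t :: v2].
Proof.
move=> tR; case: w1 => [|y w1] /=; first by case=> <- <-; left.
case=> <-; case/lastP: w2 => [|w2 r].
  by rewrite cats1 => /rcons_inj[_ e]; rewrite -e eqxx in tR.
rewrite -rcons_cons -rcons_cat => /rcons_inj[-> <-].
by right; exists w1, w2.
Qed.

Lemma all_inputE w : inputs w = (w == nseq (size w) Input).
Proof. by elim: w => //= t w ->. Qed.

Lemma bracketing_prefix b w1 w2 : bracketing_ b (w1 ++ w2) ->
  (rights w1 <= lefts w1)%N.
Proof. by case/bracketing_balanced => /(_ (size w1)); rewrite take_size_cat. Qed.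

Lemma bracketing_suffix b w1 w2 : bracketing_ b (w1 ++ w2) ->
  (lefts w2 <= rights w2)%N.
Proof.
move=> h; have := bracketing_prefix h.
have [_] := bracketing_balanced h; rewrite -/(lefts _) -/(rights _) !countE; lia.
Qed.

Lemma no_opens_inputs w : rights w = lefts w -> ~~ has opens w -> inputs w.
Proof.
move=> e h; have l0 : lefts w = 0%N.
  apply/eqP; rewrite -leqn0 leqNgt -has_count; apply: contra h.
  by apply: sub_has => -[].
have {e l0} : ~~ has (pred1 RightBracket) w by rewrite has_count -[count _ _]/(rights w) e l0.
by elim: w h => //= -[] w IH.
Qed.

Lemma bracketing_inputs b w : bracketing_ b w -> ~~ has opens w -> inputs w.
Proof. by move/bracketing_balanced => [_ e]; apply: no_opens_inputs. Qed.

Lemma bracketing_nseq n : (0 < n)%N -> bracketing_ false (nseq n Input).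
Proof.
case: n => // n _; elim: n => [|n IHn]; first by constructor.
by rewrite -[nseq _ _]/([:: Input] ++ nseq n.+1 Input); apply: bracketing_cat IHn; constructor.
Qed.

Lemma drop_match_cat k u v : (k + lefts u < rights u)%N ->
  drop_match k (u ++ v) = drop_match k u ++ v.
Proof.
elim: u k => [|t u IHu] k; first by rewrite [rights _]/=.
rewrite !countE; case: t => /= h; try by rewrite IHu //; lia.
by case: k h => [//|k] h; rewrite IHu //; lia.
Qed.

Lemma drop_match_prefix k u v :
  (forall n, rights (take n u) <= k + lefts (take n u))%N ->
  drop_match k (u ++ v) = u ++ drop_match (k + lefts u - rights u) v.
Proof.
elim: u k => [|t u IHu] k h; first by rewrite /= addn0 subn0.
have {}h n : (rights (t :: take n u) <= k + lefts (t :: take n u))%N by exact: (h n.+1).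
move: h; rewrite !countE; case: t => /= h.
- by rewrite IHu => // n; have := h n; rewrite !countE.
- by rewrite IHu => // n; have := h n; rewrite !countE.
- rewrite IHu => [|n]; last by have := h n; rewrite !countE /=; lia.
  by congr (_ :: _ ++ drop_match _ _); lia.
- have := h 0%N; rewrite take0 !countE /=; case: k h => // k h _.
  rewrite IHu => [|n]; last by have := h n; rewrite !countE /=; lia.
  by congr (_ :: _ ++ drop_match _ _); lia.
Qed.

Lemma drop_match_bracketing b u : bracketing_ b u ->
  drop_match 0 (rcons u RightBracket) = u.
Proof.
case/bracketing_balanced => h e; rewrite -cats1 drop_match_prefix //.
by rewrite /rights e add0n subnn /= cats0.
Qed.

Lemma drop_match_after_left b u1 u2 v : bracketing_ b (u1 ++ LeftBracket :: u2) ->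
  drop_match 0 (u2 ++ v) = drop_match 0 u2 ++ v.
Proof. by move/bracketing_suffix => h; rewrite drop_match_cat. Qed.

Lemma bracket_letters_drop_match k w :
  bracket_letters (drop_match k w) = bracket_letters w.
Proof. by elim: w k => [|[] w IHw] [|k] //=; rewrite ?/bracket_letters /= ?[pmap _ _]IHw. Qed.

Lemma count_opens_drop_match k w :
  count opens (drop_match k w) = count opens w.
Proof. by elim: w k => [|[] w IHw] [|k] //=; rewrite IHw. Qed.

Lemma bracketing_remove_left b w1 w2 : bracketing_ b (w1 ++ LeftBracket :: w2) ->
  let w := w1 ++ drop_match 0 w2 in
  has opens w /\ exists2 c, bracketing_ c w & b = false -> c = false.
Proof.
move: {-2}(w1 ++ _) (erefl (w1 ++ LeftBracket :: w2)) => w e h.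
elim: h w1 w2 e => {b w} [||u hu IH hs|b c u v hu IHu hv IHv] w1 w2.
- by case: w1 => [|? []].
- by case: w1 => [|? []].
- case/wrap_eq_cat_cons => // [[-> _ ->]|[v1 [v2 [-> -> eu]]]] /=.
    by rewrite (drop_match_bracketing hu) hs; split=> //; exists false.
  have /= [hs' [c hc hf]] := IH _ _ eu.
  have -> : v1 ++ drop_match 0 (rcons v2 RightBracket)
     = rcons (v1 ++ drop_match 0 v2) RightBracket.
    by rewrite -!cats1 -catA (drop_match_after_left (u1 := v1) (b := false)) // -eu.
  split=> //; exists true => //; constructor=> //; rewrite -(hf erefl) //.
- move=> e; case: (cat_eq_cat_cons e) => [[u2 eu ->]|[v1 -> ev]] /=.
    rewrite (drop_match_after_left (u1 := w1) (b := b)) -?eu // catA.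
    have /= [hs [d hd _]] := IHu _ _ eu.
    by split; [rewrite has_cat hs|exists false => //; apply: bracketing_cat hd hv].
  have /= [hs [d hd _]] := IHv _ _ ev; rewrite -catA.
  by split; [rewrite has_cat hs orbT|exists false => //; apply: bracketing_cat hu hd].
Qed.

Lemma bracketing_collapse b w1 w2 v : lefts v = 0%N -> rights v = 0%N ->
  bracketing_ b (w1 ++ LeftBracket :: v ++ RightBracket :: w2) ->
  bracketing_ b (w1 ++ Star :: w2).
Proof.
move=> lv rv.
move: {-2}(w1 ++ _) (erefl (w1 ++ LeftBracket :: v ++ RightBracket :: w2)) => w e h.
elim: h w1 w2 e => {b w} [||u hu IH hs|b c u1 u2 h1 IH1 h2 IH2] w1 w2.
- by case: w1 => [|? []].
- by case: w1 => [|? []].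
- case/wrap_eq_cat_cons => // [[-> _]|[v1 [v2 [-> e eu]]]] /=.
    case/lastP: w2 => [|w2 r]; first by constructor.
    rewrite -rcons_cons -rcons_cat => /rcons_inj[e _].
    move: hu; rewrite -e -cat_rcons => /bracketing_prefix.
    by rewrite -cats1 !countE lv rv.
  case/lastP: w2 e => [|w2 r].
    rewrite cats1 => /rcons_inj[e]; move: hu; rewrite eu -e => /bracketing_suffix.
    by rewrite !countE lv rv.
  rewrite -rcons_cons -rcons_cat => /rcons_inj[e ->].
  rewrite -rcons_cons -rcons_cat; constructor; last by rewrite has_cat /= orbT.
  by apply: IH; rewrite eu e.
- move=> e; case: (cat_eq_cat_cons e) => [[u3 e1]|[u3 -> e2]] /=; last first.
    by rewrite -catA; apply: bracketing_cat h1 (IH2 _ _ e2).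
  move=> e2; case: (cat_eq_cat_cons (esym e2)) => [[u4 e3 ->]|[u4 e3 _]].
    rewrite -cat_cons catA; apply: bracketing_cat h2; apply: IH1.
    by rewrite e1 e3.
  move: h1; rewrite e1 => /bracketing_suffix.
  move: lv rv; rewrite e3 !countE /=; lia.
Qed.

Definition first_token (w : seq token) := nth Input w (find (predC1 Input) w).

Lemma first_token_cat u v :
  first_token (u ++ v) = if inputs u then first_token v else first_token u.
Proof.
rewrite /first_token; elim: u => [|t u IHu] //=.
by case: (t == Input).
Qed.

Lemma first_tokenP w : ~~ inputs w ->
  exists n v, [/\ w = nseq n Input ++ first_token w :: v, first_token w != Input
    & find (predC1 Input) w = n].
Proof.
rewrite /first_token; elim: w => [|t w IHw] //=.
case: eqP => [->|/eqP tN] /= => [/IHw[n [v [e ? en]]]|_]; last by exists 0%N, w.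
by exists n.+1, v; split; rewrite /= ?en -?[in nth _ _ n]en -?e.
Qed.

Definition last_token w := first_token (rev w).

Lemma last_token_cat u v :
  last_token (u ++ v) = if inputs v then last_token u else last_token v.
Proof. by rewrite /last_token rev_cat first_token_cat all_rev. Qed.

Lemma last_tokenP w : ~~ inputs w ->
  exists n v, [/\ w = v ++ last_token w :: nseq n Input, last_token w != Input
    & find (predC1 Input) (rev w) = n].
Proof.
rewrite -all_rev => /first_tokenP[n [v [e ? ?]]]; exists n, (rev v); split=> //.
by rewrite -[LHS]revK e rev_cat rev_cons rev_nseq cat_rcons.
Qed.

Lemma first_token_inputs w : inputs w -> first_token w = Input.
Proof.
move=> h; rewrite /first_token nth_default // leqNgt -has_find.
by rewrite has_predC h.
Qed.

(* The test made by [remove_pair] on a [*] standing between [w1] and [w2]. *)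
Definition enclosed (w1 w2 : seq token) :=
  (last_token w1 == LeftBracket) && (first_token w2 == RightBracket).

Lemma enclosedP w1 w2 : enclosed w1 w2 ->
  exists v1 m n v2,
    [/\ w1 = v1 ++ LeftBracket :: nseq m Input,
        w2 = nseq n Input ++ RightBracket :: v2,
        find (predC1 Input) (rev w1) = m & find (predC1 Input) w2 = n].
Proof.
case/andP=> /eqP e1 /eqP e2.
have /last_tokenP[m [v1 [h1 _ f1]]] : ~~ inputs w1.
  by rewrite -all_rev; apply: contra_eqN e1 => /first_token_inputs h; rewrite /last_token h.
have /first_tokenP[n [v2 [h2 _ f2]]] : ~~ inputs w2.
  by apply: contra_eqN e2 => /first_token_inputs ->.
by exists v1, m, n, v2; rewrite -e1 -e2.
Qed.

Lemma bracketing_enclosed b c1 u1 u2 c2 : bracketing_ b (u1 ++ Star :: u2) ->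
  enclosed (c1 ++ u1) (u2 ++ c2)
  = if inputs u1 && inputs u2 then enclosed c1 c2 else enclosed u1 u2.
Proof.
move=> h; rewrite /enclosed last_token_cat first_token_cat.
have [i1|i1] := boolP (inputs u1); have [i2|i2] := boolP (inputs u2) => //=.
- have [n [v [e _ _]]] := first_tokenP i2.
  suff /negbTE -> : first_token u2 != RightBracket by rewrite !andbF.
  apply/eqP => eR; move: h i1; rewrite e eR -cat_cons -cat_rcons catA.
  move/bracketing_prefix; rewrite -cats1 !countE all_inputE => + /eqP eu1.
  by rewrite eu1 /lefts /rights !count_nseq.
- have [n [v [e _ _]]] := last_tokenP i1.
  suff /negbTE -> : last_token u1 != LeftBracket by [].
  apply/eqP => eL; move: h i2; rewrite e eL -catA.
  move/bracketing_suffix; rewrite /= !countE all_inputE => + /eqP eu2.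
  by rewrite eu2 /lefts /rights !count_nseq.
Qed.

Lemma bracketing_expand b w1 w2 j : bracketing_ b (w1 ++ Star :: w2) ->
  ~~ enclosed w1 w2 -> (0 < j)%N ->
  let w := w1 ++ nseq j Input ++ w2 in
  exists2 c, bracketing_ c w & b = false -> c = false.
Proof.
move: {-2}(w1 ++ _) (erefl (w1 ++ Star :: w2)) => w e h + j0.
elim: h w1 w2 e => {b w} [||u hu IH hs|b c u v hu IHu hv IHv] w1 w2.
- by case: w1 => [|? []].
- case: w1 => [|? []] // [<-] _ /=; exists false => //.
  by rewrite cats0; exact: bracketing_nseq.
- case/wrap_eq_cat_cons => // [[]|[v1 [v2 [-> -> eu]]]] //.
  rewrite -cat1s -[rcons v2 _]cats1 (bracketing_enclosed (b := false)) -?eu //.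
  case: ifP => // i12 /(IH _ _ eu)[c hc /(_ erefl) ec]; exists true => //.
  rewrite !catA cats1 -catA /=; constructor; rewrite -?ec //.
  apply: contraFT i12 => hs'; move: (bracketing_inputs hc hs').
  by rewrite !all_cat => /and3P[-> _ ->].
- move=> e; case: (cat_eq_cat_cons e) => [[u2 eu ->]|[v1 -> ev]] /=.
    rewrite -[w1]cat0s (bracketing_enclosed (b := b)) -?eu // cat0s.
    have -> : enclosed [::] v = false by [].
    case: ifP => [/andP[i1 i2] _|_ /(IHu _ _ eu)[d hd _]].
      exists false => //; rewrite !catA; apply: bracketing_cat hv.
      move: i1 i2; rewrite !all_inputE => /eqP -> /eqP ->.
      by rewrite -!nseqD; apply: bracketing_nseq; lia.
    by exists false => //; rewrite !catA; apply: bracketing_cat hv; rewrite -catA; exact: hd.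
  rewrite -[w2]cats0 (bracketing_enclosed (b := c)) -?ev // cats0.
  have -> : enclosed u [::] = false by rewrite /enclosed andbF.
  case: ifP => [/andP[i1 i2] _|_ /(IHv _ _ ev)[d hd _]]; exists false => //; rewrite -catA.
    apply: bracketing_cat hu _; move: i1 i2; rewrite !all_inputE => /eqP -> /eqP ->.
    by rewrite -!nseqD; apply: bracketing_nseq; lia.
  exact: bracketing_cat hu hd.
Qed.

Lemma bracketing_index b c w : bracketing_ b w -> bracketing_ c w -> b = c.
Proof.
by move=> /bracketing_closed hb /bracketing_closed hc; apply/idP/idP; rewrite hb hc.
Qed.

Lemma bracketing_unwrap b c w : bracketing_ c w ->
  bracketing_ b (LeftBracket :: rcons w RightBracket) ->
  bracketing_ false w /\ has opens w.
Proof.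
move=> hw; move: {-2}(_ :: _) (erefl (LeftBracket :: rcons w RightBracket)) => v e h.
case: h e => [||u hu hs|{}b d u1 u2 h1 h2] //.
- by case=> /rcons_inj[<-].
- by case/esym/(wrap_not_cat h1 h2 hw).
Qed.

Lemma not_bracketing_wrap2 w : bracketing w ->
  bracketing (LeftBracket :: rcons w RightBracket) ->
  ~ bracketing (LeftBracket :: rcons (LeftBracket :: rcons w RightBracket) RightBracket).
Proof.
move=> hw [c hc] [d hd]; have [h0 _] := bracketing_unwrap hc hd.
have [_ hF] := bracketing_closed h0.
by have: false by apply: hF; right; exists w.
Qed.

Section SubBimodules.
Variables (S : pzRingType) (V : bimodType S).

Lemma sub_bimoduleN (P : V -> Prop) x : sub_bimodule P -> P x -> P (- x).
Proof. by case=> P0 PB _ _ hx; rewrite -sub0r; apply: PB. Qed.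

Lemma sub_bimoduleD (P : V -> Prop) x y : sub_bimodule P -> P x -> P y -> P (x + y).
Proof.
move=> hP hx hy; rewrite -[y]opprK; case: (hP) => _ + _ _.
by apply => //; apply: sub_bimoduleN.
Qed.

Lemma sub_bimodule_sum (P : V -> Prop) (J : Type) (r : seq J) (p : pred J) F :
  sub_bimodule P -> (forall j, p j -> P (F j)) -> P (\sum_(j <- r | p j) F j).
Proof.
move=> hP hF; elim/big_ind: _ => // [|x y]; first by case: hP.
exact: sub_bimoduleD.
Qed.

Lemma span_sub_bimodule (R : V -> Prop) :
  (forall s x, R x -> R (s *: x)) -> (forall x s, R x -> R (ract x s)) ->
  sub_bimodule (Defs.span R).
Proof.
move=> RZ Rr; split=> [|x y|s x h|x s h]; first exact: span0.
- exact: spanB.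
- elim: h => [{}x /RZ h||{}x y _ hx _ hy]; first exact: span_gen.
    by rewrite scaler0; exact: span0.
  by rewrite scalerBr; exact: spanB.
- elim: h => [{}x /Rr h||{}x y _ hx _ hy]; first exact: span_gen.
    by rewrite ract0l; exact: span0.
  by rewrite ractBl; exact: spanB.
Qed.
End SubBimodules.

Lemma ractZsign (S : pzRingType) (V : bimodType S) n (x : V) s :
  ract ((-1) ^+ n *: x) s = (-1) ^+ n *: ract x s.
Proof. by rewrite scale_ract. Qed.

Section Grading.
Variables (S : pzRingType) (L : choiceType) (M : L -> bimodType S) (X : shapes L).
Local Notation T := (tensor_sum M X).
Local Notation part := (@tensor_part S L M X).

Lemma part_pure n (j : X) l : degree j = n -> part n (pure j l).
Proof. by move=> e; apply: span_gen; exists j => //; exists l. Qed.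

Lemma part_sub_bimodule n : sub_bimodule (part n).
Proof.
apply: span_sub_bimodule => [s x|x s] [j e [l ->]]; exists j => //.
  by exists (lscale s l); rewrite scale_pure.
by exists (rscale l s); rewrite ract_pure.
Qed.

Lemma part_amul m n (x y : T) : part m x -> part n y -> part (m + n) (amul x y).
Proof.
have [p0 pB _ _] := part_sub_bimodule (m + n).
elim=> [{}x [i ei [l ->]]||{}x x' _ hx _ hx']; last first.
- by move=> hy; rewrite amulDl amulNl; apply: pB; [apply: hx|apply: hx'].
- by rewrite amul0l.
elim=> [{}y [j ej [k ->]]||{}y y' _ hy _ hy']; last first.
- by rewrite amulDr amulNr; apply: pB.
- by rewrite amul0r.
have [hi|/pure_eq0 ->] := boolP (word_ok i l); last by rewrite amul0l.
have [hj|/pure_eq0 ->] := boolP (word_ok j k); last by rewrite amul0r.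
rewrite /amul /= tmulE //; apply: part_pure.
by move: hi hj => /andP[ai _] /andP[aj _]; rewrite degree_cat // ei ej.
Qed.

Definition component n : T -> T :=
  tensor_lift (fun j l => if degree j == n then pure j l else 0).

Lemma component_multilinear n :
  multilinear (fun (j : X) l => if degree j == n then pure j l else 0 : T).
Proof. by split=> *; case: ifP => _; rewrite ?addr0 ?pure_add ?pure_balance. Qed.

Lemma componentB n : zmod_morphism (component n).
Proof. exact: (tensor_liftB (component_multilinear n)). Qed.
HB.instance Definition _ n :=
  GRing.isZmodMorphism.Build T T (component n) (componentB n).

Lemma componentE n (j : X) l :
  component n (pure j l) = if degree j == n then pure j l else 0.
Proof.
have [h|/pure_eq0 ->] := boolP (word_ok j l); last by rewrite raddf0 if_same.
exact: (tensor_liftE (component_multilinear n)).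
Qed.

Lemma component_part m n x : part m x -> component n x = if m == n then x else 0.
Proof.
elim=> [{}x [j e [l ->]]||{}x y _ hx _ hy]; first by rewrite componentE e.
  by rewrite raddf0 if_same.
by rewrite raddfB /= hx hy; case: ifP; rewrite ?subr0.
Qed.

Lemma tensor_sum_components x : exists n, exists2 c : nat -> T,
  forall i, part i (c i) & x = \sum_(i < n) c i.
Proof.
have widen (n m : nat) (c : nat -> T) : (n <= m)%N -> \sum_(i < n) c i =
    \sum_(i < m) (if (i < n)%N then c i else 0).
  by move=> h; rewrite -big_mkcond -big_ord_widen.
elim/tensor_sum_ind: x => [|x y [n [c hc ->]] [m [d hd ->]]|j l _].
- by exists 0%N, (fun=> 0) => [i|]; [case: (part_sub_bimodule i)|rewrite big_ord0].
- exists (maxn n m), (fun i => (if (i < n)%N then c i else 0) - (if (i < m)%N then d i else 0)).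
    by move=> i; case: (part_sub_bimodule i) => p0 pB _ _; apply: pB; case: ifP.
  by rewrite sumrB -!widen ?leq_maxl ?leq_maxr.
- exists (degree j).+1, (fun i => if i == degree j then pure j l else 0).
    by move=> i; case: eqP => [->|_]; [apply: part_pure|case: (part_sub_bimodule i)].
  rewrite (bigD1 ord_max) //= eqxx big1 ?addr0 // => i.
  by rewrite -val_eqE /= => /negbTE ->.
Qed.

Lemma tensor_sum_graded : graded_algebra part.
Proof.
split; [exact: part_sub_bimodule|exact: tensor_sum_components| |exact: part_amul].
move=> n c hc e i lt_in; have := congr1 (component i) e.
rewrite raddf0 raddf_sum (bigD1 (Ordinal lt_in)) //= (component_part _ (hc i)) eqxx.
rewrite big1 ?addr0 // => k; rewrite -val_eqE /= => /negbTE ne.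
by rewrite (component_part _ (hc k)) ne.
Qed.
End Grading.

Lemma map_eq_cat (A B : Type) (f : A -> B) l s1 s2 : map f l = s1 ++ s2 ->
  exists l1 l2, [/\ l = l1 ++ l2, map f l1 = s1 & map f l2 = s2].
Proof.
elim: s1 l => [|x s1 IH] l /=; first by exists [::], l.
by case: l => //= y l [<- /IH[l1 [l2 [-> <- <-]]]]; exists (y :: l1), l2.
Qed.

Lemma bracket_letters_cat u v :
  bracket_letters (u ++ v) = bracket_letters u ++ bracket_letters v.
Proof. exact: pmap_cat. Qed.

Lemma bracket_letters_cons t w : bracket_letters (t :: w) =
  match t with Input => [:: false] | Star => [:: true] | _ => [::] end
  ++ bracket_letters w.
Proof. by case: t. Qed.

Lemma bracket_letters_inputs n : bracket_letters (nseq n Input) = nseq n false.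
Proof. by elim: n => //= n <-. Qed.

Definition lettersE := (bracket_letters_cat, bracket_letters_cons, bracket_letters_inputs).

Arguments bracket_letters : simpl never.

Section RemovePair.
Variables (S : pzRingType) (V : bimodType S) (I : ideal (tensor_algebra V)).
Local Notation Bletter := (letter (bracket_module I)).
Local Notation Bl := (mkletter (M := bracket_module I)).
Local Notation bpure := (pure (X := bracketings) (M := bracket_module I)).
Local Notation bword_ok := (word_ok (X := bracketings) (M := bracket_module I)).
Implicit Types (l m : seq Bletter) (w u v : seq token).

Lemma bword_okP w l :
  reflect (bracketing w /\ map tag l = bracket_letters w) (bword_ok w l).
Proof.
by apply: (iffP andP) => [[/asboolP h /eqP]|[/asboolP h /eqP]].
Qed.

Lemma bword_ok_cat_inv u v l : bracketing u -> bracketing v -> bword_ok (u ++ v) l ->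
  exists l1 l2, [/\ l = l1 ++ l2, bword_ok u l1 & bword_ok v l2].
Proof.
move=> hu hv /bword_okP[_]; rewrite bracket_letters_cat => /map_eq_cat[l1 [l2 [-> h1 h2]]].
by exists l1, l2; split=> //; apply/bword_okP.
Qed.

Lemma remove_pair_left w1 w2 l : remove_pair (w1 ++ LeftBracket :: w2) l (size w1)
  = bpure (w1 ++ drop_match 0 w2) l.
Proof.
rewrite /remove_pair nth_cat ltnn subnn /= take_size_cat //.
by rewrite -cat_rcons drop_size_cat ?size_rcons.
Qed.

Lemma remove_pair_expand w1 w2 l1 (i : ideal_module I) l2 : ~~ enclosed w1 w2 ->
  map tag l1 = bracket_letters w1 ->
  remove_pair (w1 ++ Star :: w2) (l1 ++ Bl (i := true) i :: l2) (size w1)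
  = expand w1 w2 l1 l2 (val i).
Proof.
move=> ne /(congr1 size); rewrite size_map => sl.
rewrite /remove_pair nth_cat ltnn subnn /= take_size_cat //.
rewrite -cat_rcons drop_size_cat ?size_rcons // -/(first_token _) -/(last_token _).
by rewrite -/(enclosed _ _) (negbTE ne) nth_cat sl ltnn subnn /= take_size_cat //
  -cat_rcons drop_size_cat ?size_rcons ?sl.
Qed.

Lemma remove_pair_absorb w1 w2 a b l1 la (i : ideal_module I) lb l2 :
  map tag l1 = bracket_letters w1 -> map tag la = nseq a false ->
  map tag lb = nseq b false ->
  remove_pair (w1 ++ LeftBracket :: nseq a Input ++ Star :: nseq b Input
                 ++ RightBracket :: w2)
    (l1 ++ la ++ Bl (i := true) i :: lb ++ l2) (size w1 + a.+1)
  = bpure (w1 ++ Star :: w2) (l1 ++ Bl (i := true) (absorb la i lb) :: l2).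
Proof.
move=> /(congr1 size) + /(congr1 size) + /(congr1 size).
rewrite !size_map !size_nseq => s1 sa sb.
set u1 := w1 ++ LeftBracket :: nseq a Input.
set u2 := nseq b Input ++ RightBracket :: w2.
have -> : w1 ++ LeftBracket :: nseq a Input ++ Star :: u2 = u1 ++ Star :: u2.
  by rewrite -catA.
have su : size u1 = (size w1 + a.+1)%N by rewrite size_cat /= size_nseq.
rewrite -su /remove_pair nth_cat ltnn subnn /= take_size_cat //.
rewrite -cat_rcons drop_size_cat ?size_rcons //.
have f1 n v t : t != Input -> find (predC1 Input) (nseq n Input ++ t :: v) = n.
  by elim: n => [|n IHn] ht /=; rewrite ?ht // IHn.
have -> : rev u1 = nseq a Input ++ LeftBracket :: rev w1.
  by rewrite rev_cat rev_cons rev_nseq cat_rcons.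
have f2 n v t : nth Input (nseq n Input ++ t :: v) n = t.
  by rewrite nth_cat size_nseq ltnn subnn.
rewrite !f1 // !f2 /=.
have sk : size (bracket_letters u1) = (size l1 + size la)%N.
  by rewrite !lettersE size_cat s1 sa size_nseq.
rewrite sk sa addnK -sa.
have -> : (size u1 - (size la).+1 = size w1)%N by rewrite su sa addnK.
have -> : drop b.+1 u2 = w2 by rewrite /u2 -cat_rcons drop_size_cat ?size_rcons ?size_nseq.
rewrite [l1 ++ _]catA nth_cat size_cat ltnn subnn take_size_cat ?size_cat //.
rewrite -[(l1 ++ la) ++ _]cat_rcons drop_size_cat ?size_rcons ?size_cat //.
rewrite !take_size_cat // !(@drop_size_cat _ _ (rcons _ _)) ?size_rcons ?size_cat //.
by rewrite take_size_cat // !drop_size_cat.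
Qed.

Inductive spot w l : nat -> Prop :=
| SpotLeft w1 w2 : w = w1 ++ LeftBracket :: w2 -> spot w l (size w1)
| SpotAbsorb w1 w2 a b l1 la (i : ideal_module I) lb l2 :
    w = w1 ++ LeftBracket :: nseq a Input ++ Star :: nseq b Input
                 ++ RightBracket :: w2 ->
    l = l1 ++ la ++ Bl (i := true) i :: lb ++ l2 ->
    map tag l1 = bracket_letters w1 -> map tag la = nseq a false ->
    map tag lb = nseq b false -> map tag l2 = bracket_letters w2 ->
    spot w l (size w1 + a.+1)
| SpotExpand w1 w2 l1 (i : ideal_module I) l2 :
    w = w1 ++ Star :: w2 -> l = l1 ++ Bl (i := true) i :: l2 ->
    map tag l1 = bracket_letters w1 -> map tag l2 = bracket_letters w2 ->
    ~~ enclosed w1 w2 -> spot w l (size w1).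

Lemma spotP w l p : map tag l = bracket_letters w -> (p < size w)%N ->
  opens (nth Input w p) -> spot w l p.
Proof.
move=> + lt_p.
have [w1 [w2 [t [-> ->]]]] : exists w1 w2 t, w = w1 ++ t :: w2 /\ p = size w1.
  exists (take p w), (drop p.+1 w), (nth Input w p).
  by rewrite -drop_nth // cat_take_drop size_takel // ltnW.
rewrite nth_cat ltnn subnn /=; case: t => // hl _; last exact: SpotLeft.
move: hl; rewrite lettersE => /map_eq_cat[l1 [l' [-> h1]]].
rewrite lettersE; case: l' => // -[[] i] // l2 [h2].
have [e|] := boolP (enclosed w1 w2); last exact: SpotExpand.
have [v1 [a [b [v2 [e1 e2 _ _]]]]] := enclosedP e.
move: h1 h2; rewrite e1 e2 !lettersE /= => /map_eq_cat[k1 [la [-> h1 ha]]].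
move=> /map_eq_cat[lb [k2 [-> hb h2]]].
rewrite size_cat /= size_nseq -!catA.
exact: (@SpotAbsorb _ _ v1 v2 a b k1 la i lb k2).
Qed.
End RemovePair.

Section Contexts.
Variables (S : pzRingType) (V : bimodType S) (I : ideal (tensor_algebra V)).
Local Notation Vletter := (letter (fun _ : unit => V)).
Local Notation Bletter := (letter (bracket_module I)).
Local Notation Bl := (mkletter (M := bracket_module I)).
Local Notation F := (bracket_algebra I).
Local Notation bpure := (pure (X := bracketings) (M := bracket_module I)).
Local Notation bword_ok := (word_ok (X := bracketings) (M := bracket_module I)).
Local Notation vword_ok := (word_ok (X := powers) (M := fun _ : unit => V)).
Implicit Types (l m : seq Bletter) (w u v : seq token) (n : seq Vletter).

Lemma remove_left_ok w1 w2 l : bword_ok (w1 ++ LeftBracket :: w2) l ->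
  bword_ok (w1 ++ drop_match 0 w2) l.
Proof.
move=> /bword_okP[[b /bracketing_remove_left[_ [c hc _]]] e].
apply/bword_okP; split; first by exists c.
by rewrite e !lettersE bracket_letters_drop_match.
Qed.

Lemma collapse_ok w1 w2 a b l1 la (i k : ideal_module I) lb l2 :
  map tag l1 = bracket_letters w1 -> map tag l2 = bracket_letters w2 ->
  bword_ok (w1 ++ LeftBracket :: nseq a Input ++ Star :: nseq b Input
                 ++ RightBracket :: w2)
    (l1 ++ la ++ Bl (i := true) i :: lb ++ l2) ->
  bword_ok (w1 ++ Star :: w2) (l1 ++ Bl (i := true) k :: l2).
Proof.
move=> e1 e2 /bword_okP[[c]]; rewrite -[Star :: nseq b _ ++ _]cat_cons catA => hc _.
apply/bword_okP; split; last by rewrite map_cat /= !lettersE e1 e2.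
exists c; apply: bracketing_collapse hc.
  by rewrite !countE /= /lefts !count_nseq.
by rewrite !countE /= /rights !count_nseq.
Qed.

Lemma tag_of_Vletter n : map tag (map (@of_Vletter S V I) n) = nseq (size n) false.
Proof. by elim: n => //= x n ->. Qed.

Lemma vword_okP (j : nat) n : reflect ((0 < j)%N /\ size n = j) (vword_ok j n).
Proof.
rewrite /word_ok /=; apply: (iffP andP) => -[j0 e]; split=> //.
  by rewrite -(size_map tag) (eqP e) size_nseq.
by rewrite -e; apply/eqP; elim: n {e} => //= -[[] x] n ->.
Qed.

Lemma expand_ok w1 w2 l1 l2 (i : ideal_module I) (j : nat) n :
  bword_ok (w1 ++ Star :: w2) (l1 ++ Bl (i := true) i :: l2) ->
  map tag l1 = bracket_letters w1 -> ~~ enclosed w1 w2 -> vword_ok j n ->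
  bword_ok (w1 ++ nseq j Input ++ w2) (l1 ++ map (@of_Vletter S V I) n ++ l2).
Proof.
move=> /bword_okP[[b hb] e] e1 ne /vword_okP[j0 sn].
have [c hc _] := bracketing_expand hb ne j0.
apply/bword_okP; split; first by exists c.
move: e; rewrite !map_cat !lettersE /= e1 => /eqP.
by rewrite eqseq_cat // => /andP[_ /eqP[->]]; rewrite tag_of_Vletter sn.
Qed.

Definition ctx (c1 c2 : seq token) l1 l2 : F -> F :=
  tensor_lift (fun (w : bracketings) m => bpure (c1 ++ w ++ c2) (l1 ++ m ++ l2)).

Lemma ctx_multilinear (c1 c2 : seq token) l1 l2 : multilinear (A := F)
  (fun (w : bracketings) m => bpure (c1 ++ w ++ c2) (l1 ++ m ++ l2)).
Proof.
by split=> *; rewrite -!catA !cat_cons !(catA l1) (pure_add, pure_balance).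
Qed.

Lemma ctxB c1 c2 l1 l2 : zmod_morphism (ctx c1 c2 l1 l2).
Proof. exact: (tensor_liftB (ctx_multilinear c1 c2 l1 l2)). Qed.
HB.instance Definition _ c1 c2 l1 l2 :=
  GRing.isZmodMorphism.Build F F (ctx c1 c2 l1 l2) (ctxB c1 c2 l1 l2).

Lemma ctxE c1 c2 l1 l2 w m : bword_ok w m ->
  ctx c1 c2 l1 l2 (bpure w m) = bpure (c1 ++ w ++ c2) (l1 ++ m ++ l2).
Proof. exact: (tensor_liftE (ctx_multilinear c1 c2 l1 l2)). Qed.

HB.instance Definition _ w1 w2 l m :=
  GRing.isZmodMorphism.Build (tensor_algebra V) F (@expand S V I w1 w2 l m) (expandB w1 w2 l m).

Lemma ctx_expand c1 c2 k1 k2 w1 w2 l1 l2 (i : ideal_module I) t :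
  bword_ok (w1 ++ Star :: w2) (l1 ++ Bl (i := true) i :: l2) ->
  map tag l1 = bracket_letters w1 -> ~~ enclosed w1 w2 ->
  ctx c1 c2 k1 k2 (expand w1 w2 l1 l2 t)
  = expand (c1 ++ w1) (w2 ++ c2) (k1 ++ l1) (l2 ++ k2) t.
Proof.
move=> ok e1 ne; elim/tensor_sum_ind: t => [|x y hx hy|j n okn].
- by rewrite !raddf0.
- by rewrite !raddfB /= hx hy.
by rewrite !expandE // ctxE ?(expand_ok ok) // -!catA.
Qed.

Lemma remove_pair_ctx b c1 u c2 k1 l k2 p : bracketing_ b u -> bword_ok u l ->
  map tag k1 = bracket_letters c1 ->
  (p < size u)%N -> opens (nth Input u p) ->
  (enclosed c1 c2 -> count (predC1 Input) u != 1%N) ->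
  remove_pair (c1 ++ u ++ c2) (k1 ++ l ++ k2) (size c1 + p)
  = ctx c1 c2 k1 k2 (remove_pair u l p).
Proof.
move=> hu ok ec lt_p op nc; have /bword_okP[_ el] := ok.
case: (spotP el lt_p op) => [w1 w2 eu|w1 w2 a c l1 la i lb l2 eu e e1 ea ec' e2|
   w1 w2 l1 i l2 eu e e1 e2 ne]; subst.
- rewrite -catA cat_cons catA -size_cat !remove_pair_left.
  by rewrite ctxE ?remove_left_ok // (drop_match_after_left _ hu) -!catA.
- rewrite [in RHS]remove_pair_absorb // ctxE; last exact: collapse_ok ok.
  rewrite addnA -size_cat -!catA !cat_cons -!catA !cat_cons -!catA !cat_cons.
  rewrite (catA c1) (catA k1) remove_pair_absorb ?lettersE ?map_cat ?ec ?e1 //.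
  by rewrite -!catA.
- rewrite [in RHS]remove_pair_expand // (ctx_expand _ _ _ _ _ ok) //.
  rewrite -size_cat -!catA !cat_cons (catA c1) (catA k1) remove_pair_expand //.
    rewrite (bracketing_enclosed _ _ hu); case: ifP => // /andP[i1 i2].
    apply/negP => /nc; rewrite count_cat /=.
    have h v : inputs v -> count (predC1 Input) v = 0%N.
      by rewrite all_inputE => /eqP->; rewrite count_nseq.
    by rewrite !h.
  by rewrite map_cat lettersE ec e1.
Qed.
End Contexts.

Section Homotopy.
Variables (S : pzRingType) (V : bimodType S) (I : ideal (tensor_algebra V)).
Local Notation Vletter := (letter (fun _ : unit => V)).
Local Notation Bletter := (letter (bracket_module I)).
Local Notation Vl := (mkletter (M := fun _ : unit => V) (i := tt)).
Local Notation Bl := (mkletter (M := bracket_module I)).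
Local Notation T := (tensor_algebra V).
Local Notation F := (bracket_algebra I).
Local Notation bpure := (pure (X := bracketings) (M := bracket_module I)).
Local Notation bword_ok := (word_ok (X := bracketings) (M := bracket_module I)).
Local Notation vpure := (pure (X := powers) (M := fun _ : unit => V)).
Local Notation vword_ok := (word_ok (X := powers) (M := fun _ : unit => V)).
Implicit Types (l m : seq Bletter) (w u v : seq token) (n : seq Vletter).

Definition inn : T -> F := expand [::] [::] [::] [::].
HB.instance Definition _ := GRing.Additive.on inn.

Lemma innE (j : nat) n : vword_ok j n ->
  inn (vpure j n) = bpure (nseq j Input) (map (@of_Vletter S V I) n).
Proof. by move=> ok; rewrite /inn expandE // !cats0. Qed.

Definition istar (i : ideal_module I) : F := bpure [:: Star] [:: Bl (i := true) i].

Lemma istarD : {morph istar : x y / x + y}.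
Proof. by move=> x y; rewrite /istar (pure_add _ [::] [::] (i := true : bool)). Qed.

Lemma istar0 : istar 0 = 0.
Proof. by apply: (addrI (istar 0)); rewrite -istarD !addr0. Qed.

Lemma istarB : {morph istar : x y / x - y}.
Proof. by move=> x y; apply: (addIr (istar y)); rewrite -istarD !subrK. Qed.

Definition bracketed : F -> F := ctx [:: LeftBracket] [:: RightBracket] [::] [::].
HB.instance Definition _ := GRing.Additive.on bracketed.

Lemma bracketedE w l : bword_ok w l ->
  bracketed (bpure w l) = bpure (LeftBracket :: rcons w RightBracket) l.
Proof. by move=> ok; rewrite /bracketed ctxE //= cats0 cats1. Qed.

Lemma bracketed_eq0 w l : ~ bracketing (LeftBracket :: rcons w RightBracket) ->
  bracketed (bpure w l) = 0.
Proof.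
move=> h; have [ok|/pure_eq0 ->] := boolP (bword_ok w l); last by rewrite raddf0.
by rewrite bracketedE // pure_eq0 //; apply/bword_okP => -[/h].
Qed.

Lemma bracketed_closed b w l : bracketing_ b w -> b || ~~ has opens w -> bracketed (bpure w l) = 0.
Proof.
move=> hw h; apply: bracketed_eq0 => -[c hc].
have [h0 ho] := bracketing_unwrap hw hc.
by move: h; rewrite ho (bracketing_index hw h0).
Qed.

Lemma bracketed_bracketed x : bracketed (bracketed x) = 0.
Proof.
elim/tensor_sum_ind: x => [|x y hx hy|w l ok]; first by rewrite !raddf0.
  by rewrite !raddfB /= hx hy subrr.
rewrite bracketedE //; have /bword_okP[hw _] := ok.
have [[b hb]|nb] := pselect (bracketing (LeftBracket :: rcons w RightBracket)).
  by apply: bracketed_eq0; apply: not_bracketing_wrap2 hw _; exists b.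
by rewrite pure_eq0 ?raddf0 //; apply/bword_okP => -[/nb].
Qed.

Lemma bracketed_istar i : bracketed (istar i) = 0.
Proof. by apply: (@bracketed_closed true) => //; constructor. Qed.

Lemma bracketed_inn t : bracketed (inn t) = 0.
Proof.
elim/tensor_sum_ind: t => [|x y hx hy|j n ok]; first by rewrite !raddf0.
  by rewrite !raddfB /= hx hy subrr.
have /vword_okP[j0 _] := ok; rewrite innE //.
by apply: bracketed_closed (bracketing_nseq j0) _; rewrite has_nseq andbF.
Qed.

Definition proj : F -> T := tensor_lift (fun (w : bracketings) l =>
  if inputs w then vpure (size w) [seq Vl (to_V x) | x : Bletter <- l] else 0).

Lemma proj_multilinear : multilinear (A := T) (fun (w : bracketings) l =>
  if inputs w then vpure (size w) [seq Vl (to_V x) | x : Bletter <- l] else 0).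
Proof.
split=> [w l m k x y _|w l m k k' x s y _]; case: ifP => _; rewrite ?addr0 //.
  by rewrite !map_cat !map_cons to_VD pure_add.
by rewrite !map_cat !map_cons to_V_ract to_V_scale pure_balance.
Qed.

HB.instance Definition _ := GRing.isZmodMorphism.Build F T proj
  (tensor_liftB proj_multilinear).

Lemma projE w l : bword_ok w l -> proj (bpure w l) =
  if inputs w then vpure (size w) [seq Vl (to_V x) | x : Bletter <- l] else 0.
Proof. exact: (tensor_liftE proj_multilinear). Qed.

Lemma proj_eq0 w l : ~~ inputs w -> proj (bpure w l) = 0.
Proof.
move=> /negbTE h; have [ok|/pure_eq0 ->] := boolP (bword_ok w l); last by rewrite raddf0.
by rewrite projE // h.
Qed.

Lemma proj_istar i : proj (istar i) = 0.
Proof. exact: proj_eq0. Qed.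

Lemma proj_bracketed x : proj (bracketed x) = 0.
Proof.
elim/tensor_sum_ind: x => [|x y hx hy|w l ok]; first by rewrite !raddf0.
  by rewrite !raddfB /= hx hy subrr.
by rewrite bracketedE // proj_eq0.
Qed.

Lemma proj_expand w1 w2 l1 l2 t : ~~ (inputs w1 && inputs w2) ->
  proj (expand w1 w2 l1 l2 t) = 0.
Proof.
move=> h; elim/tensor_sum_ind: t => [|x y hx hy|j n ok]; first by rewrite !raddf0.
  by rewrite !raddfB /= hx hy subrr.
rewrite expandE // proj_eq0 // !all_cat; apply: contra h.
by case/and3P=> -> _ ->.
Qed.

Lemma proj_inn t : proj (inn t) = t.
Proof.
elim/tensor_sum_ind: t => [|x y hx hy|j n ok]; first by rewrite !raddf0.
  by rewrite !raddfB /= hx hy.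
have /vword_okP[j0 sn] := ok; rewrite innE // projE.
  rewrite all_nseq orbT size_nseq -map_comp; congr vpure.
  by elim: n {ok sn} => //= -[[] x] n {2}<-.
apply/bword_okP; split; first by exists false; exact: bracketing_nseq.
by rewrite tag_of_Vletter lettersE sn.
Qed.

Lemma inputs_size w l : bword_ok w l -> inputs w ->
  map tag l = nseq (size l) false /\ size l = size w.
Proof.
move=> /bword_okP[_ e]; rewrite all_inputE => /eqP wE.
have sl : size l = size w by rewrite -(size_map tag) e {1}wE lettersE size_nseq.
by split=> //; rewrite e sl {1}wE lettersE.
Qed.

Lemma proj_ok w l : bword_ok w l -> inputs w ->
  vword_ok (size w) [seq Vl (to_V x) | x : Bletter <- l].
Proof.
move=> ok iw; apply/vword_okP; rewrite size_map (inputs_size ok iw).2; split=> //.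
by have /bword_okP[[b /bracketing_neq0]] := ok; case: (w).
Qed.

Lemma of_VletterK l : map tag l = nseq (size l) false ->
  map (@of_Vletter S V I) [seq Vl (to_V x) | x : Bletter <- l] = l.
Proof. by elim: l => //= -[[] x] l IH [] // /IH {2}<-. Qed.

Lemma inn_proj w l : bword_ok w l -> inputs w -> inn (proj (bpure w l)) = bpure w l.
Proof.
move=> ok iw; rewrite projE // iw innE ?proj_ok // of_VletterK ?(inputs_size ok iw).1 //.
by move: iw; rewrite all_inputE => /eqP <-.
Qed.

Definition absorbT l (t : T) m : T :=
  foldl (fun y x => amul y (tensor1 (to_V x)))
    (foldr (fun x y => amul (tensor1 (to_V x)) y) t l) m.

Lemma val_absorb l (i : ideal_module I) m : val (absorb l i m) = absorbT l (val i) m.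
Proof.
rewrite /absorb /absorbT; set j := foldr _ _ _; set t := foldr _ _ _.
have -> : t = val j by rewrite /t /j {t j}; elim: l => //= x l ->.
by elim: m j {t} => //= x m IHm j; rewrite IHm.
Qed.

Lemma absorbTB l m x y : absorbT l (x - y) m = absorbT l x m - absorbT l y m.
Proof.
rewrite /absorbT.
have -> : foldr (fun a b => amul (tensor1 (to_V a)) b) (x - y) l =
    foldr (fun a b => amul (tensor1 (to_V a)) b) x l -
    foldr (fun a b => amul (tensor1 (to_V a)) b) y l :> T.
  by elim: l => //= a l ->; rewrite amulDr amulNr.
by elim: m (foldr _ _ _) (foldr _ _ _) => //= a m IHm u v; rewrite amulDl amulNl IHm.
Qed.

Lemma absorbT0 l m : absorbT l 0 m = 0.
Proof. by have := absorbTB l m 0 0; rewrite !subrr. Qed.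

Lemma absorbTE l m (j : nat) n : vword_ok j n -> absorbT l (vpure j n) m
  = vpure (size l + j + size m)%N
      ([seq Vl (to_V x) | x : Bletter <- l] ++ n ++ [seq Vl (to_V x) | x : Bletter <- m]).
Proof.
have ok1 (x : Bletter) : vword_ok 1%N [:: Vl (to_V x)] by apply/vword_okP.
move=> ok; rewrite /absorbT.
have [-> {}ok] : foldr (fun a b => amul (tensor1 (to_V a)) b) (vpure j n) l =
    vpure (size l + j)%N ([seq Vl (to_V x) | x : Bletter <- l] ++ n) :> T /\
    vword_ok (size l + j)%N ([seq Vl (to_V x) | x : Bletter <- l] ++ n).
  elim: l => //= a l [-> ok']; split; last exact: (word_ok_cat (ok1 a) ok').
  by rewrite /tensor1 /amul /= tmulE.
rewrite catA; move: ok; move: (_ + j)%N (_ ++ n) => {}j {}n.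
elim: m j n => [|a m IHm] j n ok /=; first by rewrite addn0 cats0.
rewrite {2}/tensor1 /amul /= tmulE // IHm -?catA -?[cat_shape _ _]/(j + 1)%N.
  by rewrite addn1 addSnnS.
exact: (word_ok_cat ok (ok1 a)).
Qed.

Lemma expand_inputs l m t :
  map tag l = nseq (size l) false -> map tag m = nseq (size m) false ->
  expand (nseq (size l) Input) (nseq (size m) Input) l m t = inn (absorbT l t m).
Proof.
move=> el em; elim/tensor_sum_ind: t => [|x y hx hy|j n ok].
- by rewrite absorbT0 !raddf0.
- by rewrite raddfB absorbTB raddfB /= hx hy.
rewrite expandE // absorbTE // innE; last first.
  apply/vword_okP; have /vword_okP[j0 sn] := ok.
  by rewrite !size_cat !size_map sn addnA; split=> //; lia.
by rewrite !nseqD !map_cat !of_VletterK // -!catA.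
Qed.
End Homotopy.

Section Differential.
Variables (S : pzRingType) (V : bimodType S) (I : ideal (tensor_algebra V)).
Local Notation Vletter := (letter (fun _ : unit => V)).
Local Notation Bletter := (letter (bracket_module I)).
Local Notation Bl := (mkletter (M := bracket_module I)).
Local Notation T := (tensor_algebra V).
Local Notation F := (bracket_algebra I).
Local Notation D := (@bracket_diff S V I).
Local Notation part := (@tensor_part S bool (bracket_module I) bracketings).
Local Notation bpure := (pure (X := bracketings) (M := bracket_module I)).
Local Notation bword_ok := (word_ok (X := bracketings) (M := bracket_module I)).
Implicit Types (l m : seq Bletter) (w u v : seq token) (n : seq Vletter).

HB.instance Definition _ := GRing.isZmodMorphism.Build F F D
  (tensor_liftB (@bracket_diff_multilinear S V I)).

Lemma diff_pure w l : bword_ok w l -> D (bpure w l) =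
  \sum_(0 <= p < size w | opens (nth Input w p))
     (-1) ^+ count opens (take p w) *: remove_pair w l p.
Proof. by move=> ok; rewrite big_mkord bracket_diffE. Qed.

Lemma diff_eq0 w l : ~~ has opens w -> D (bpure w l) = 0.
Proof.
move=> h; have [ok|/pure_eq0 ->] := boolP (bword_ok w l); last by rewrite raddf0.
rewrite diff_pure // big_nat_cond big1 // => p /andP[lt_p op].
by case/hasP: h; exists (nth Input w p) => //; apply: mem_nth.
Qed.

Lemma diff_inn t : D (inn I t) = 0.
Proof.
elim/tensor_sum_ind: t => [|x y hx hy|j n ok]; first by rewrite !raddf0.
  by rewrite !raddfB /= hx hy subrr.
by rewrite innE // diff_eq0 // has_nseq andbF.
Qed.

Lemma istar_ok (i : ideal_module I) : bword_ok [:: Star] [:: Bl (i := true) i].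
Proof. by apply/bword_okP; split=> //; exists true; constructor. Qed.

Lemma diff_istar (i : ideal_module I) : D (istar i) = inn I (val i).
Proof.
rewrite /istar diff_pure ?istar_ok // big_mkcond big_nat1 scale1r.
exact: (@remove_pair_expand _ _ _ [::] [::] [::] i [::]).
Qed.

Lemma ctx_mulr v m x : bword_ok v m ->
  ctx [::] v [::] m x = amul x (bpure v m) :> F.
Proof.
move=> okv; elim/tensor_sum_ind: x => [|x y hx hy|u l ok].
- by rewrite raddf0 amul0l.
- by rewrite raddfB /= hx hy amulDl amulNl.
by rewrite ctxE // /amul /= tmulE.
Qed.

Lemma ctx_mull u l x : bword_ok u l ->
  ctx u [::] l [::] x = amul (bpure u l) x :> F.
Proof.
move=> oku; elim/tensor_sum_ind: x => [|x y hx hy|v m ok].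
- by rewrite raddf0 amul0r.
- by rewrite raddfB /= hx hy amulDr amulNr.
by rewrite ctxE // !cats0 /amul /= tmulE.
Qed.

Lemma diff_cat u v l m : bword_ok u l -> bword_ok v m ->
  D (bpure (u ++ v) (l ++ m)) = amul (D (bpure u l)) (bpure v m)
    + (-1) ^+ count opens u *: amul (bpure u l) (D (bpure v m)) :> F.
Proof.
move=> oku okv; rewrite [LHS]diff_pure; last exact: (word_ok_cat oku okv).
have [[bu hu] eu] := bword_okP _ _ oku; have [[bv hv] ev] := bword_okP _ _ okv.
rewrite size_cat (big_cat_nat (n := size u)) ?leq_addr //=; congr (_ + _).
  rewrite -ctx_mulr // (diff_pure oku) raddf_sum /=.
  rewrite big_nat_cond [RHS]big_nat_cond; apply: eq_big => p.
    by rewrite nth_cat; case: ltnP => //; rewrite andbF.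
  rewrite nth_cat => /andP[/andP[_ lt_p]]; rewrite lt_p => op.
  rewrite raddfZsign take_cat lt_p; congr (_ *: _).
  exact: (@remove_pair_ctx _ _ _ bu [::] u v [::] l m p).
have hp p : (p + size u < size u)%N = false by rewrite ltnNge leq_addl.
rewrite -{1}[size u]add0n big_addn addKn -ctx_mull // (diff_pure okv) raddf_sum /=.
rewrite scaler_sumr big_nat_cond [RHS]big_nat_cond; apply: eq_big => p.
  by rewrite nth_cat hp addnK.
rewrite nth_cat hp addnK => /andP[/andP[_ lt_p] op].
rewrite raddfZsign scalerA -exprD take_cat hp addnK count_cat.
congr (_ *: _); rewrite addnC -[v in LHS]cats0 -[m in LHS]cats0.
by apply: (@remove_pair_ctx _ _ _ bv u v [::] l m [::] p) => //; rewrite /enclosed andbF.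
Qed.

Lemma diff_amul d (x y : F) : part d x ->
  D (amul x y) = amul (D x) y + (-1) ^+ d *: amul x (D y).
Proof.
elim=> [{}x [u /= <- [l ->]]||{}x x' _ hx _ hx']; last first.
- by rewrite amulDl amulNl raddfB /= hx hx' raddfB /= !amulDl !amulNl scalerBr opprD addrACA.
- by rewrite raddf0 !amul0l raddf0 scaler0 addr0.
have [oku|/pure_eq0 ->] := boolP (bword_ok u l); last first.
  by rewrite raddf0 !amul0l raddf0 scaler0 addr0.
elim/tensor_sum_ind: y => [|y y' hy hy'|v m okv].
- by rewrite raddf0 !amul0r raddf0 scaler0 addr0.
- by rewrite raddfB !amulDr !amulNr raddfB /= hy hy' scalerBr opprD addrACA.
by rewrite {1}/amul /= tmulE //; exact: diff_cat.
Qed.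

Lemma proj_remove_pair w l p : bword_ok w l -> (p < size w)%N ->
  opens (nth Input w p) -> proj (remove_pair w l p) \in ideal_pred I.
Proof.
have I0 : (0 : T) \in ideal_pred I by case: (ideal_closedP I) => -[].
move=> ok lt_p op; have /bword_okP[[c hw] el] := ok.
case: (spotP el lt_p op) => [w1 w2 eu|w1 w2 a b l1 la i lb l2 eu e e1 ea eb e2|
   w1 w2 l1 i l2 eu e e1 e2 ne]; subst.
- rewrite remove_pair_left proj_eq0 //.
  have [h _] := bracketing_remove_left hw.
  by apply/negP; rewrite all_inputE => /eqP h'; move: h; rewrite h' has_nseq andbF.
- by rewrite remove_pair_absorb // proj_eq0 // all_cat andbF.
- rewrite remove_pair_expand //.
  have [/andP[i1 i2]|h] := boolP (inputs w1 && inputs w2); last by rewrite proj_expand.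
  move: i1 i2 e1 e2; rewrite !all_inputE => /eqP-> /eqP ->; rewrite !lettersE => e1 e2.
  have s1 : size l1 = size w1 by rewrite -(size_map tag) e1 size_nseq.
  have s2 : size l2 = size w2 by rewrite -(size_map tag) e2 size_nseq.
  rewrite -s1 -s2 expand_inputs ?s1 ?s2 // proj_inn -val_absorb; exact: valP.
Qed.

Lemma proj_diff x : proj (D x) \in ideal_pred I.
Proof.
have [[I0 IB] _ _ _ _] := ideal_closedP I.
elim/tensor_sum_ind: x => [|x y hx hy|w l ok]; first by rewrite !raddf0.
  by rewrite !raddfB; apply: IB.
rewrite diff_pure // big_nat_cond raddf_sum /=.
have IN (t : T) : t \in ideal_pred I -> - t \in ideal_pred I by rewrite -sub0r; apply: IB.
elim/big_ind: _ => // [t t' ht ht'|p /andP[lt_p op]].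
  by rewrite -[t']opprK; apply/IB/IN.
rewrite raddfZsign -signr_odd scaler_sign.
by case: odd; [apply: IN|]; apply: proj_remove_pair.
Qed.

Definition into_ideal (t : T) : ideal_module I := insubd 0 t.

Lemma into_idealK t : t \in ideal_pred I -> val (into_ideal t) = t.
Proof. by move=> ht; rewrite insubdK. Qed.

Lemma val_into_ideal (i : ideal_module I) : into_ideal (val i) = i.
Proof. exact: valKd. Qed.

Lemma into_ideal0 : into_ideal 0 = 0.
Proof. exact: (val_into_ideal 0). Qed.

Lemma into_idealB t t' : t \in ideal_pred I -> t' \in ideal_pred I ->
  into_ideal (t - t') = into_ideal t - into_ideal t'.
Proof.
move=> ht ht'; apply: val_inj; rewrite raddfB /= !into_idealK //.
by have [[_ IB] _ _ _ _] := ideal_closedP I; apply: IB.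
Qed.

Lemma remove_pair_wrap w l p : bword_ok w l -> (p < size w)%N ->
  opens (nth Input w p) ->
  remove_pair (LeftBracket :: rcons w RightBracket) l p.+1
  = bracketed (remove_pair w l p) + istar (into_ideal (proj (remove_pair w l p))) :> F.
Proof.
move=> ok lt_p op; have /bword_okP[[c hw] el] := ok.
have H : (count (predC1 Input) w != 1%N) -> proj (remove_pair w l p) = 0 ->
    remove_pair (LeftBracket :: rcons w RightBracket) l p.+1
    = bracketed (remove_pair w l p) + istar (into_ideal (proj (remove_pair w l p))) :> F.
  move=> nc ->; rewrite into_ideal0 istar0 addr0 -cats1.
  have := @remove_pair_ctx _ _ _ c [:: LeftBracket] w [:: RightBracket] [::] l [::] p hw ok.
  by rewrite !cats0 add1n; apply.
case: (spotP el lt_p op) H => [w1 w2 eu|w1 w2 a b l1 la i lb l2 eu e e1 ea eb e2|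
   w1 w2 l1 i l2 eu e e1 e2 ne] H; subst.
- have [h _] := bracketing_remove_left hw.
  apply: H.
    rewrite gtn_eqF // (leq_trans _ (sub_count (a1 := opens) _ _)) //; last by case.
    rewrite count_cat /= addnCA ltnS -(count_opens_drop_match 0 w2) -count_cat.
    by rewrite -has_count.
  rewrite remove_pair_left proj_eq0 //.
  by apply/negP; rewrite all_inputE => /eqP h'; move: h; rewrite h' has_nseq andbF.
- apply: H; last by rewrite remove_pair_absorb // proj_eq0 // all_cat andbF.
  by rewrite count_cat /= count_cat /= count_cat /=; lia.
have [/andP[i1 i2]|h] := boolP (inputs w1 && inputs w2); last first.
  apply: H; last by rewrite remove_pair_expand // proj_expand.
  apply: contra h; rewrite count_cat /= addnCA -[1%N in eqbRHS]addn0 eqn_add2l.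
  have h u : inputs u = (count (predC1 Input) u == 0)%N.
    by rewrite -[inputs u]negbK -has_predC has_count -eqn0Ngt.
  by rewrite addn_eq0 !h.
move: i1 i2 {H}; rewrite !all_inputE => /eqP z1 /eqP z2.
have e1' : map tag l1 = nseq (size w1) false by rewrite e1 {1}z1 lettersE.
have e2' : map tag l2 = nseq (size w2) false by rewrite e2 {1}z2 lettersE.
have s1 : size l1 = size w1 by rewrite -(size_map tag) e1' size_nseq.
have s2 : size l2 = size w2 by rewrite -(size_map tag) e2' size_nseq.
have absorbE : expand w1 w2 l1 l2 (val i) = inn I (absorbT l1 (val i) l2).
  by rewrite {1}z1 {1}z2 -s1 -s2 expand_inputs ?s1 ?s2.
rewrite remove_pair_expand // absorbE bracketed_inn add0r proj_inn.
rewrite -val_absorb val_into_ideal.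
have := @remove_pair_absorb _ _ I [::] [::] (size w1) (size w2) [::] l1 i l2 [::].
rewrite !cats0 -z1 -z2 => /(_ erefl e1' e2') /= h.
by rewrite /istar -h add0n -cats1 -catA.
Qed.

Lemma sign_count_wrap w p (y : F) : (p < size w)%N ->
  (-1) ^+ count opens (take p.+1 (LeftBracket :: rcons w RightBracket)) *: y
  = - ((-1) ^+ count opens (take p w) *: y).
Proof.
move=> lt_p; rewrite /= -cats1 takel_cat ?(ltnW lt_p) // add1n exprS.
by rewrite mulN1r scaleNr.
Qed.

(* Encloses everything in a new pair; the [istar] term takes over in degree 1,
   where a single [*] and the inputs around it collapse to [*] instead. *)
Definition cone (x : F) : F := bracketed x + istar (into_ideal (proj x)).

Lemma cone0 : cone 0 = 0.
Proof. by rewrite /cone !raddf0 into_ideal0 istar0 addr0. Qed.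

Lemma coneB x y : proj x \in ideal_pred I -> proj y \in ideal_pred I ->
  cone (x - y) = cone x - cone y.
Proof.
by move=> hx hy; rewrite /cone !raddfB /= into_idealB // istarB opprD addrACA.
Qed.

Lemma ideal_closedB (t t' : T) : t \in ideal_pred I -> t' \in ideal_pred I ->
  t - t' \in ideal_pred I.
Proof. by have [[_ IB] _ _ _ _] := ideal_closedP I; apply: IB. Qed.

Lemma ideal_closed0 : (0 : T) \in ideal_pred I.
Proof. by have [[]] := ideal_closedP I. Qed.

Lemma cone_diff w l : bword_ok w l -> cone (D (bpure w l)) =
  \sum_(0 <= p < size w | opens (nth Input w p))
    (-1) ^+ count opens (take p w) *: cone (remove_pair w l p).
Proof.
move=> ok; rewrite diff_pure // big_nat_cond [RHS]big_nat_cond.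
set r := index_iota _ _.
suff [] : proj (\sum_(p <- r | (0 <= p < size w)%N && opens (nth Input w p))
     (-1) ^+ count opens (take p w) *: remove_pair w l p) \in ideal_pred I /\
   cone (\sum_(p <- r | (0 <= p < size w)%N && opens (nth Input w p))
     (-1) ^+ count opens (take p w) *: remove_pair w l p) =
   \sum_(p <- r | (0 <= p < size w)%N && opens (nth Input w p))
    (-1) ^+ count opens (take p w) *: cone (remove_pair w l p) by [].
elim/big_rec2: _ => [|p x y /andP[lt_p op] [hy <-]].
  by rewrite raddf0 cone0; split=> //; exact: ideal_closed0.
have hz := proj_remove_pair ok lt_p op; set z := remove_pair w l p in hz *.
rewrite -signr_odd !scaler_sign; case: odd.
  rewrite addrC [- cone z + _]addrC raddfB /=.
  by split; [exact: ideal_closedB|rewrite coneB].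
have hN : proj (- y) \in ideal_pred I.
  by rewrite raddfN /= -sub0r; apply: ideal_closedB hy; exact: ideal_closed0.
have coneN : cone (- y) = - cone y.
  by rewrite -sub0r coneB ?raddf0 ?ideal_closed0 // cone0 sub0r.
rewrite -{1 2}[y]opprK raddfB /=.
by split; [exact: ideal_closedB|rewrite coneB // coneN opprK].
Qed.

Lemma diff_wrap w l : bword_ok w l ->
  bword_ok (LeftBracket :: rcons w RightBracket) l ->
  D (bpure (LeftBracket :: rcons w RightBracket) l)
  = bpure w l - cone (D (bpure w l)).
Proof.
move=> ok okw; rewrite diff_pure // cone_diff //= size_rcons.
have /bword_okP[[b hw] _] := ok.
rewrite big_mkcond big_nat_recl // scale1r; congr (_ + _).
  rewrite -[in RHS](drop_match_bracketing hw).
  exact: (@remove_pair_left _ _ _ [::] (rcons w RightBracket) l).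
rewrite big_nat_recr //= nth_rcons ltnn eqxx addr0 -sumrN.
rewrite [RHS]big_mkcond; apply: eq_big_nat => p /andP[_ lt_p].
rewrite nth_rcons lt_p; case: ifP => // op.
by rewrite sign_count_wrap // remove_pair_wrap.
Qed.

Lemma homotopy x : D (bracketed x) + cone (D x) = x - inn I (proj x).
Proof.
elim/tensor_sum_ind: x => [|x y hx hy|w l ok].
- by rewrite !raddf0 cone0 !addr0.
- have -> : D (bracketed (x - y)) + cone (D (x - y))
      = (D (bracketed x) + cone (D x)) - (D (bracketed y) + cone (D y)).
    rewrite (raddfB (@bracketed S V I)) !(raddfB D) /= coneB ?proj_diff //.
    by rewrite addrACA -opprD.
  rewrite hx hy (raddfB (@proj S V I)) (raddfB (inn I)) /=.
  have e (a a' b b' : F) : a - a' - (b - b') = a - b - (a' - b').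
    by rewrite !opprB [b' - b]addrC addrACA [- a' + _]addrC.
  exact: e.
have /bword_okP[[b hw] el] := ok.
have [ho|ho] := boolP (has opens w); last first.
  have iw := bracketing_inputs hw ho.
  rewrite inn_proj // (bracketed_closed _ hw) ?ho ?orbT //.
  by rewrite diff_eq0 // cone0 !raddf0 addr0 subrr.
rewrite [proj (bpure w l)]proj_eq0; last first.
  by apply/negP; rewrite all_inputE => /eqP h; move: ho; rewrite h has_nseq andbF.
rewrite raddf0 subr0; case: hw ho ok el => {b w} [||u hu hs|b c u v hu hv] ho ok el //.
- case: l ok el => [|[[] i] [|? ?]] // ok el.
  rewrite bracketed_istar diff_istar raddf0 add0r /cone bracketed_inn proj_inn.
  by rewrite val_into_ideal add0r.
- have oku : bword_ok u l.
    apply/bword_okP; split; first by exists false.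
    by rewrite el lettersE -cats1 !lettersE cats0.
  rewrite -(bracketedE oku) bracketed_bracketed raddf0 add0r.
  rewrite [in LHS]bracketedE // diff_wrap //.
  set z := cone (D _); have zE : bracketed z = 0 /\ proj z = 0.
    by rewrite /z /cone (raddfD (@bracketed S V I)) (raddfD (@proj S V I)) /=
      bracketed_bracketed bracketed_istar
       proj_bracketed proj_istar !addr0.
  have [z1 z2] := zE; rewrite /cone !raddfB /= z1 z2 !subr0 proj_eq0.
    by rewrite into_ideal0 istar0 addr0.
  by apply/negP; rewrite all_inputE => /eqP h; move: hs; rewrite h has_nseq andbF.
- rewrite bracketedE // diff_wrap ?subrK //.
  have /bword_okP[_ e] := ok; apply/bword_okP; split.
    by exists true; constructor=> //; apply: bracketing_cat hu hv.
  by rewrite e -cats1 [RHS]lettersE !lettersE cats0.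
Qed.
End Differential.

Section Resolution.
Variables (S : pzRingType) (V : bimodType S) (I : ideal (tensor_algebra V)).
Local Notation Vletter := (letter (fun _ : unit => V)).
Local Notation Bletter := (letter (bracket_module I)).
Local Notation Bl := (mkletter (M := bracket_module I)).
Local Notation F := (bracket_algebra I).
Local Notation D := (@bracket_diff S V I).
Local Notation part := (@tensor_part S bool (bracket_module I) bracketings).
Local Notation bpure := (pure (X := bracketings) (M := bracket_module I)).
Local Notation bword_ok := (word_ok (X := bracketings) (M := bracket_module I)).
Implicit Types (l m : seq Bletter) (w u v : seq token) (n : seq Vletter).

Definition iinput (x : V) : F := bpure [:: Input] [:: Bl (i := false) x].

Lemma bracket_algebra_ind (P : F -> Prop) :
  P 0 -> (forall x y, P x -> P y -> P (x - y)) ->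
  (forall x, P (iinput x)) -> (forall i, P (istar i)) ->
  (forall x, P x -> P (bracketed x)) ->
  (forall d x y, part d x -> P x -> P y -> P (amul x y)) ->
  forall x, P x.
Proof.
move=> P0 PB Pi Ps Pw Pm; elim/tensor_sum_ind => // w l ok.
have /bword_okP[[b hw] e] := ok; elim: hw l ok e => {b w}
  [||u hu IH hs|b c u v hu IHu hv IHv] l ok e.
- by case: l e {ok} => [|[[] x] [|? ?]] // _; exact: Pi.
- by case: l e {ok} => [|[[] x] [|? ?]] // _; exact: Ps.
- have oku : bword_ok u l.
    apply/bword_okP; split; first by exists false.
    by rewrite e lettersE -cats1 !lettersE cats0.
  by rewrite -(bracketedE oku); apply/Pw/IH => //; have /bword_okP[] := oku.
- have [| |l1 [l2 [-> ok1 ok2]]] := bword_ok_cat_inv _ _ ok; [by exists b|by exists c|].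
  have -> : bpure (u ++ v) (l1 ++ l2) = amul (bpure u l1) (bpure v l2) :> F.
    by rewrite /amul /= tmulE.
  apply: (Pm (count opens u)); first exact: part_pure.
    by apply: IHu => //; have /bword_okP[] := ok1.
  by apply: IHv => //; have /bword_okP[] := ok2.
Qed.

Lemma expand_part w1 w2 l1 l2 t :
  part (count opens w1 + count opens w2)%N (expand w1 w2 l1 l2 t).
Proof.
have [p0 pB _ _] := part_sub_bimodule (bracket_module I) bracketings
  (count opens w1 + count opens w2).
elim/tensor_sum_ind: t => [|x y hx hy|j n ok].
- by rewrite raddf0.
- by rewrite raddfB; apply: pB.
rewrite expandE //; apply: part_pure => /=.
by rewrite !count_cat count_nseq.
Qed.

Lemma inn_part t : part 0 (inn I t).
Proof. exact: (expand_part [::] [::]). Qed.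

Lemma remove_pair_part w l p : bword_ok w l -> (p < size w)%N ->
  opens (nth Input w p) -> part (count opens w).-1 (remove_pair w l p).
Proof.
move=> ok lt_p op; have /bword_okP[[c hw] el] := ok.
case: (spotP el lt_p op) => [w1 w2 eu|w1 w2 a b l1 la i lb l2 eu e e1 ea eb e2|
   w1 w2 l1 i l2 eu e e1 e2 ne]; subst.
- rewrite remove_pair_left; apply: part_pure => /=.
  by rewrite !count_cat count_opens_drop_match /= addnCA.
- rewrite remove_pair_absorb //; apply: part_pure.
  by rewrite /= !count_cat /= !count_cat /= !count_cat !count_nseq /=; lia.
- rewrite remove_pair_expand // !count_cat /= addnCA; exact: expand_part.
Qed.

Lemma diff_part d x : part d.+1 x -> part d (D x).
Proof.
have pd := part_sub_bimodule (bracket_module I) bracketings d.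
have [p0 pB pZ _] := pd.
elim=> [{}x [w /= ew [l ->]]||{}x y _ hx _ hy]; last by rewrite raddfB; apply: pB.
  have [ok|/pure_eq0 ->] := boolP (bword_ok w l); last by rewrite raddf0.
  rewrite diff_pure // big_nat_cond; apply: (sub_bimodule_sum _ pd).
  move=> p /andP[/andP[_ lt_p] op]; apply: pZ.
  by have := remove_pair_part ok lt_p op; rewrite ew.
by rewrite raddf0.
Qed.

Lemma diff_part0 x : part 0 x -> D x = 0.
Proof.
elim=> [{}x [w /= ew [l ->]]||{}x y _ hx _ hy].
- by rewrite diff_eq0 // has_count ew.
- by rewrite raddf0.
- by rewrite raddfB /= hx hy subrr.
Qed.

Lemma ctx_scale c1 c2 s x :
  ctx c1 c2 [::] [::] (s *: x) = s *: ctx c1 c2 [::] [::] x :> F.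
Proof.
elim/tensor_sum_ind: x => [|x y hx hy|w l ok].
- by rewrite !(scaler0, raddf0).
- by rewrite scalerBr !raddfB /= hx hy.
by rewrite scale_pure !ctxE ?word_ok_lscale // scale_pure !cats0.
Qed.

Lemma ctx_ract c1 c2 s x :
  ctx c1 c2 [::] [::] (ract x s) = ract (ctx c1 c2 [::] [::] x) s :> F.
Proof.
elim/tensor_sum_ind: x => [|x y hx hy|w l ok].
- by rewrite !(ract0l, raddf0).
- by rewrite ractBl !raddfB /= hx hy ractBl.
by rewrite ract_pure !ctxE ?word_ok_rscale // ract_pure !cats0.
Qed.

Lemma inn_scale s t : inn I (s *: t) = s *: inn I t.
Proof.
elim/tensor_sum_ind: t => [|x y hx hy|j n ok].
- by rewrite !(scaler0, raddf0).
- by rewrite scalerBr !raddfB /= hx hy.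
rewrite scale_pure !innE ?word_ok_lscale // scale_pure.
by case: n {ok} => [|[[] x] n].
Qed.

Lemma inn_ract t s : inn I (ract t s) = ract (inn I t) s.
Proof.
elim/tensor_sum_ind: t => [|x y hx hy|j n ok].
- by rewrite !(ract0l, raddf0).
- by rewrite ractBl !raddfB /= hx hy ractBl.
rewrite ract_pure !innE ?word_ok_rscale // ract_pure.
case/lastP: n {ok} => [|n [[] x]] //.
by rewrite -cats1 rscale_cat // !map_cat rscale_cat.
Qed.

Lemma proj_scale s (x : F) : proj (s *: x) = s *: proj x.
Proof.
elim/tensor_sum_ind: x => [|x y hx hy|w l ok].
- by rewrite !(scaler0, raddf0).
- by rewrite scalerBr !raddfB /= hx hy.
rewrite scale_pure !projE ?word_ok_lscale //; case: ifP => _; last by rewrite scaler0.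
by rewrite scale_pure; case: l {ok} => [|[k x] l] //; rewrite /lscale !map_cons to_V_scale.
Qed.

Lemma proj_ract (x : F) s : proj (ract x s) = ract (proj x) s.
Proof.
elim/tensor_sum_ind: x => [|x y hx hy|w l ok].
- by rewrite !(ract0l, raddf0).
- by rewrite ractBl !raddfB /= hx hy ractBl.
rewrite ract_pure !projE ?word_ok_rscale //; case: ifP => _; last by rewrite ract0l.
rewrite ract_pure; case/lastP: l {ok} => [|l [k x]] //.
by rewrite -cats1 rscale_cat // !map_cat rscale_cat // /rscale !map_cons to_V_ract.
Qed.

Lemma proj_amul (x y : F) : proj (amul x y) = amul (proj x) (proj y).
Proof.
elim/tensor_sum_ind: x => [|x x' hx hx'|u l oku].
- by rewrite !(amul0l, raddf0).
- by rewrite amulDl amulNl !raddfB /= hx hx' amulDl amulNl.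
elim/tensor_sum_ind: y => [|y y' hy hy'|v m okv].
- by rewrite !(amul0r, raddf0).
- by rewrite amulDr amulNr !raddfB /= hy hy' amulDr amulNr.
rewrite {1}/amul /= tmulE // !projE ?(word_ok_cat oku okv) // all_cat.
case: ifP => [/andP[iu iv]|]; last first.
  by case: ifP => iu; case: ifP => iv //; rewrite ?amul0l ?amul0r.
by rewrite iu iv size_cat map_cat /amul /= tmulE ?proj_ok.
Qed.
End Resolution.

Section QuasiIsomorphism.
Variables (S : pzRingType) (V : bimodType S) (I : ideal (tensor_algebra V)).
Local Notation Vletter := (letter (fun _ : unit => V)).
Local Notation Bletter := (letter (bracket_module I)).
Local Notation T := (tensor_algebra V).
Local Notation F := (bracket_algebra I).
Local Notation D := (@bracket_diff S V I).
Local Notation part := (@tensor_part S bool (bracket_module I) bracketings).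
Local Notation bword_ok := (word_ok (X := bracketings) (M := bracket_module I)).
Implicit Types (l m : seq Bletter) (w u v : seq token) (n : seq Vletter).

Lemma istar_scale s i : istar (s *: i) = s *: istar i :> F.
Proof. by rewrite /istar scale_pure. Qed.

Lemma istar_ract i s : istar (ract i s) = ract (istar i) s :> F.
Proof. by rewrite /istar ract_pure. Qed.

Lemma into_ideal_scale s (t : T) : t \in ideal_pred I ->
  into_ideal I (s *: t) = s *: into_ideal I t.
Proof.
move=> ht; apply: val_inj; rewrite /= into_idealK ?into_idealK //.
by have [_ IZ _ _ _] := ideal_closedP I; apply: IZ.
Qed.

Lemma into_ideal_ract (t : T) s : t \in ideal_pred I ->
  into_ideal I (ract t s) = ract (into_ideal I t) s.
Proof.
move=> ht; apply: val_inj; rewrite /= into_idealK ?into_idealK //.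
by have [_ _ Ir _ _] := ideal_closedP I; apply: Ir.
Qed.

Lemma cone_scale s (x : F) : proj x \in ideal_pred I -> cone (s *: x) = s *: cone x.
Proof.
move=> hx.
by rewrite /cone /bracketed ctx_scale proj_scale into_ideal_scale // istar_scale scalerDr.
Qed.

Lemma cone_ract (x : F) s : proj x \in ideal_pred I -> cone (ract x s) = ract (cone x) s.
Proof.
by move=> hx; rewrite /cone /bracketed ctx_ract proj_ract into_ideal_ract // istar_ract ractDl.
Qed.

Lemma diff_bracketed x : D (bracketed x) = x - inn I (proj x) - cone (D x).
Proof. by rewrite -homotopy addrK. Qed.

Lemma diff_scale s x : D (s *: x) = s *: D x.
Proof.
elim/bracket_algebra_ind: x => [|x y hx hy|x|i|x hx|d x y px hx hy].
- by rewrite !(scaler0, raddf0).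
- by rewrite scalerBr !raddfB /= hx hy.
- by rewrite /iinput scale_pure !diff_eq0 // scaler0.
- by rewrite -istar_scale !diff_istar -inn_scale.
- rewrite /bracketed -ctx_scale -![ctx _ _ _ _ _]/(bracketed _) !diff_bracketed.
  by rewrite hx proj_scale inn_scale cone_scale ?proj_diff // !scalerBr.
- have [_ _ pZ _] := part_sub_bimodule (bracket_module I) bracketings d.
  rewrite -amul_scalel !(@diff_amul _ _ _ d) //; last exact: pZ.
  by rewrite hx !amul_scalel scalerDr !scalerA commr_sign.
Qed.

Lemma diff_ract x s : D (ract x s) = ract (D x) s.
Proof.
elim/bracket_algebra_ind: x => [|x y hx hy|x|i|x hx|d x y px hx hy].
- by rewrite !(ract0l, raddf0).
- by rewrite ractBl !raddfB /= hx hy ractBl.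
- by rewrite /iinput ract_pure !diff_eq0 // ract0l.
- by rewrite -istar_ract !diff_istar -inn_ract.
- rewrite /bracketed -ctx_ract -![ctx _ _ _ _ _]/(bracketed _) !diff_bracketed.
  by rewrite hx proj_ract inn_ract cone_ract ?proj_diff // !ractBl.
- by rewrite -amul_ractr !(@diff_amul _ _ _ d) // hy !amul_ractr ractDl ractZsign.
Qed.

Lemma diff_cone x : D (cone x) = D (bracketed x) + inn I (val (into_ideal I (proj x))).
Proof. by rewrite (raddfD D) /= diff_istar. Qed.

Lemma diff_diff x : D (D x) = 0.
Proof.
elim/bracket_algebra_ind: x => [|x y hx hy|x|i|x hx|d x y px hx hy].
- by rewrite !raddf0.
- by rewrite !raddfB /= hx hy subrr.
- by rewrite /iinput diff_eq0 // raddf0.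
- by rewrite diff_istar diff_inn.
- rewrite diff_bracketed !(raddfB D) /= diff_inn subr0 diff_cone diff_bracketed hx.
  by rewrite cone0 subr0 into_idealK ?proj_diff // subrK subrr.
- rewrite (diff_amul _ px) (raddfD D) raddfZsign /= (diff_amul _ px) hy amul0r scaler0 addr0.
  case: d px => [|d] px.
    by rewrite (diff_part0 px) !amul0l raddf0 scaler0 addr0.
  rewrite (diff_amul _ (diff_part px)) hx amul0l add0r exprS mulN1r scaleNr.
  by rewrite subrr.
Qed.

Lemma augmentation_proj (x : F) : augmentation x = quotient_map I (proj x) :> quotient_algebra I.
Proof.
have aB := tensor_liftB (@augmentation_multilinear S V I).
move: x; apply: (tensor_sum_eq (A := quotient_algebra I)) => [|x y|w l ok].
- exact: aB.
- by rewrite !raddfB.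
- by rewrite (augmentationE ok) projE //; case: ifP => _; rewrite ?raddf0.
Qed.

Lemma proj_part d x : part d.+1 x -> proj x = 0.
Proof.
elim=> [{}x [w /= ew [l ->]]||{}x y _ hx _ hy].
- rewrite proj_eq0 //; apply/negP => iw; have : has opens w by rewrite has_count ew.
  by move: iw; rewrite all_inputE => /eqP->; rewrite has_nseq andbF.
- by rewrite raddf0.
- by rewrite raddfB /= hx hy subrr.
Qed.

Lemma cone_part d x : proj x \in ideal_pred I -> part d x -> part d.+1 (cone x).
Proof.
have pd := part_sub_bimodule (bracket_module I) bracketings.
move=> hx px; apply: (sub_bimoduleD (pd d.+1)); last first.
  case: d px => [|d] px; first exact: part_pure.
  by rewrite (proj_part px) into_ideal0 istar0; case: (pd d.+2).
elim: px {hx} => [{}x [w /= ew [l ->]]||{}x y _ px _ py].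
- have [ok|/pure_eq0 ->] := boolP (bword_ok w l); last first.
    by rewrite raddf0; case: (pd d.+1).
  rewrite bracketedE //; apply: part_pure.
  by rewrite /= -cats1 count_cat ew addn0.
- by rewrite raddf0; case: (pd d.+1).
- by rewrite raddfB; case: (pd d.+1) => _ + _ _; apply.
Qed.

Lemma diff_cone_cycle x : proj x \in ideal_pred I -> D x = 0 -> D (cone x) = x.
Proof.
by move=> px dx; rewrite diff_cone diff_bracketed dx cone0 subr0 into_idealK // subrK.
Qed.

Lemma bracket_dg_algebra : is_dg_algebra (bracket_resolution I).
Proof.
split; [exact: tensor_sum_graded| | |exact: diff_diff|exact: diff_amul].
- by split; [move=> x y; rewrite /= raddfB|exact: diff_scale|exact: diff_ract].
- by split; [exact: diff_part0|exact: diff_part].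
Qed.

Lemma concentrated_dg_algebra (A : nuAlgType S) : is_dg_algebra (concentrated A).
Proof.
split=> //.
- split=> [d|x|d c hc|d e x y [->|->] [->|->]] /=; rewrite ?amul0l ?amul0r; auto.
  + split=> [|x y [h|->] [h'|->]|s x [h|->]|x s [h|->]] /=;
      rewrite ?subr0 ?scaler0 ?ract0l; auto.
  + exists 1%N, (fun i => if i == 0%N then x else 0); last by rewrite big_ord1.
    by case; auto.
  + case: d => // d; rewrite big_ord_recl big1 ?addr0 => [e [|i] _|i _] //.
      by have [|] := hc i.+1.
    by have [|] := hc (bump 0 i).
- by split=> [x y|s x|x s] /=; rewrite ?subr0 ?scaler0 ?ract0l.
- by split=> // d x /=; right.
- by move=> d x y _; rewrite /= amul0l amul0r scaler0 addr0.
Qed.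

Lemma augmentation_dg_morphism : dg_morphism (augmentation (I := I)).
Proof.
split.
- split; first split.
  + by move=> x y; rewrite !augmentation_proj /= !raddfB.
  + move=> s x; rewrite !augmentation_proj proj_scale; exact/esym/qscaleE.
  + move=> x s; rewrite !augmentation_proj proj_ract; exact/esym/qractE.
  + move=> x y; rewrite !augmentation_proj proj_amul; exact/esym/qmulE.
- case=> [|d] x px; [by left|right].
  by rewrite augmentation_proj (proj_part px) raddf0.
- move=> x; transitivity (quotient_map I 0); last exact: raddf0.
  by rewrite augmentation_proj; apply/eqP; rewrite quotient_mapE subr0; exact: proj_diff.
Qed.

Lemma augmentation_quasi_isomorphism : quasi_isomorphism (augmentation (I := I)).
Proof.
move=> d; split=> [x y [px dx] [py dy] [z _ e]|z [hz _]].
  have pxy : proj (x - y) \in ideal_pred I.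
    move/eqP: e; rewrite subr_eq0 !augmentation_proj quotient_mapE -raddfB; exact.
  exists (cone (x - y)).
    apply: cone_part => //.
    by have [_ pB _ _] := part_sub_bimodule (bracket_module I) bracketings d; apply: pB.
  by rewrite /= diff_cone_cycle // raddfB /= [D x]dx [D y]dy subrr.
case: d hz => [|d] hz.
  exists (inn I (quotient_repr z)).
    by split; [exact: inn_part|exact: diff_inn].
  exists 0; first by right.
  by rewrite augmentation_proj proj_inn quotient_reprK subrr.
have -> : z = 0 by case: hz.
exists 0; first split; [|exact: raddf0|].
  by case: (part_sub_bimodule (bracket_module I) bracketings d.+1).
by exists 0; [right|rewrite augmentation_proj !raddf0 addr0].
Qed.
End QuasiIsomorphism.

(* The indecomposable bracketings, whose summands generate the algebra freely. *)
Definition atom (w : seq token) : bool :=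
  `[< w = [:: Input] \/ bracketing_ true w >].

Lemma atom_bracketing w : atom w -> bracketing w.
Proof. by case/asboolP => [->|h]; [exists false; constructor|exists true]. Qed.

Lemma atoms_bracketing ws : all atom ws -> ws != [::] -> bracketing (flatten ws).
Proof.
elim: ws => [|u [|v ws] IHws] //= /andP[/atom_bracketing hu h] _.
  by rewrite cats0.
have [c hc] := IHws h isT; have [b hb] := hu.
by exists false; apply: bracketing_cat hb hc.
Qed.

Lemma bracketing_atoms b w : bracketing_ b w ->
  exists ws, all atom ws && (flatten ws == w).
Proof.
elim=> {b w} [||u hu _ hs|b c u v _ [us /andP[au /eqP <-]] _ [vs /andP[av /eqP <-]]].
- by exists [:: [:: Input]]; rewrite /= eqxx andbT; apply/andP; split=> //; apply/asboolP; left.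
- exists [:: [:: Star]]; rewrite /= eqxx andbT; apply/andP; split=> //.
  by apply/asboolP; right; constructor.
- exists [:: LeftBracket :: rcons u RightBracket]; rewrite /= cats0 eqxx !andbT.
  by apply/asboolP; right; constructor.
- by exists (us ++ vs); rewrite all_cat au av flatten_cat eqxx.
Qed.

Lemma closed_proper_prefix u v : bracketing_ true (u ++ v) -> u != [::] ->
  v != [::] -> (rights u < lefts u)%N.
Proof.
move: {-2}true {-2}(u ++ v) (erefl true) (erefl (u ++ v)) => b w eb ew h.
case: h eb ew => // [_|w' hw _ _].
  by case: u => [|? [|? ?]] //; case: v.
case: u => [|t u] // [<-]; case/lastP: v => [|v r] //.
rewrite -rcons_cat => /rcons_inj[ew _] _ _; rewrite !countE /= add0n add1n ltnS.
by move: hw; rewrite ew => /bracketing_prefix.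
Qed.

Lemma atom_prefix u v x y : atom u -> atom v -> u ++ x = v ++ y -> u = v.
Proof.
wlog le_uv : u v x y / (size u <= size v)%N => [h au av e|].
  by case/orP: (leq_total (size u) (size v)) => ?; [apply: h e|apply/esym/(h v u y x)].
move=> au av e; have eu : u = take (size u) v.
  by rewrite -(take_size_cat x (erefl (size u))) e takel_cat // size_takel.
have [d evd] : exists d, v = u ++ d.
  by exists (drop (size u) v); rewrite [X in X ++ _]eu cat_take_drop.
case: d evd => [|t d] evd; first by rewrite evd cats0.
have [b hb] := atom_bracketing au.
have un0 := bracketing_neq0 hb; move: av; rewrite evd => /asboolP[|].
  by case: (u) un0 => [|? [|? ?]].
move/closed_proper_prefix/(_ un0 isT).
by have [_ h] := bracketing_balanced hb; rewrite /rights h ltnn.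
Qed.

Lemma atoms_inj us vs : all atom us -> all atom vs -> flatten us = flatten vs -> us = vs.
Proof.
have n0 w x : atom w -> w ++ x <> [::] by case/atom_bracketing => b /bracketing_neq0; case: w.
elim: us vs => [|u us IHus] [|v vs] //=.
- by move=> _ /andP[av _] /esym /n0.
- by move=> /andP[au _] _ /n0.
move=> /andP[au aus] /andP[av avs] e; have euv := atom_prefix au av e.
move: e; rewrite euv => /eqP; rewrite eqseq_cat // eqxx => /eqP e.
by rewrite (IHus _ aus avs e).
Qed.

Definition pieces (w : seq token) : seq (seq token) :=
  if pselect (exists ws, all atom ws && (flatten ws == w)) is left h
  then xchoose h else [::].

Lemma pieces_flatten ws : all atom ws -> pieces (flatten ws) = ws.
Proof.
move=> aws; rewrite /pieces; case: pselect => [h|[]]; last by exists ws; rewrite aws eqxx.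
by have /andP[ax /eqP] := xchooseP h; apply: atoms_inj.
Qed.

Lemma piecesP w : bracketing w ->
  [/\ all atom (pieces w), flatten (pieces w) = w & pieces w != [::]].
Proof.
case=> b hb; have [ws /andP[aws /eqP e]] := bracketing_atoms hb.
rewrite -e pieces_flatten //; split=> //; apply/eqP => w0; move: e.
by rewrite w0 => /esym e; move: (bracketing_neq0 hb); rewrite e.
Qed.

Lemma pieces_cat u v : bracketing u -> bracketing v -> pieces (u ++ v) = pieces u ++ pieces v.
Proof.
move=> /piecesP[au eu _] /piecesP[av ev _].
by rewrite -{1}eu -{1}ev -flatten_cat pieces_flatten // all_cat au av.
Qed.

Section Free.
Variables (S : pzRingType) (V : bimodType S) (I : ideal (tensor_algebra V)).
Local Notation Bletter := (letter (bracket_module I)).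
Local Notation Bl := (mkletter (M := bracket_module I)).
Local Notation F := (bracket_algebra I).
Local Notation bpure := (pure (X := bracketings) (M := bracket_module I)).
Local Notation bword_ok := (word_ok (X := bracketings) (M := bracket_module I)).
Implicit Types (l m : seq Bletter) (w u v : seq token).

Definition atomic_pure (d : nat) (x : F) : Prop :=
  exists w l, [/\ atom w, count opens w = d & x = bpure w l].

Definition atomic (d : nat) : {pred F} := span_pred (atomic_pure d).

Lemma atomic_sub_bimodule d : sub_bimodule (Defs.span (atomic_pure d)).
Proof.
apply: span_sub_bimodule => [s x|x s] [w [l [aw ew ->]]].
  by exists w, (lscale s l); rewrite scale_pure.
by exists w, (rscale l s); rewrite ract_pure.
Qed.

Fact atomic_submod_closed d : submod_closed (atomic d).
Proof.
have hd := atomic_sub_bimodule d; have [h0 _ hZ _] := hd.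
split; first by apply/span_predP.
move=> s x y /span_predP hx /span_predP hy; apply/span_predP.
by apply: (sub_bimoduleD hd) => //; apply: hZ.
Qed.
HB.instance Definition _ d :=
  GRing.isSubmodClosed.Build S F (atomic d) (atomic_submod_closed d).

Definition atomic_module (d : nat) : Type := {x : F | x \in atomic d}.
HB.instance Definition _ d := [isSub of atomic_module d for @sval F _].
HB.instance Definition _ d := [Choice of atomic_module d by <:].
HB.instance Definition _ d := [SubChoice_isSubLmodule of atomic_module d by <:].

Section AtomicBimodule.
Variable d : nat.

Fact atomic_ract_proof (x : atomic_module d) s : ract (val x) s \in atomic d.
Proof.
have [_ _ _ hr] := atomic_sub_bimodule d.
by apply/span_predP/hr/span_predP; exact: valP.
Qed.

Definition atomic_ract (x : atomic_module d) s : atomic_module d :=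
  exist _ (ract (val x) s) (atomic_ract_proof x s).

Fact atomic_ractDl s x y : atomic_ract (x + y) s = atomic_ract x s + atomic_ract y s.
Proof. by apply: val_inj; rewrite /= ractDl. Qed.
Fact atomic_ractDr x s t : atomic_ract x (s + t) = atomic_ract x s + atomic_ract x t.
Proof. by apply: val_inj; rewrite /= ractDr. Qed.
Fact atomic_ractA x s t : atomic_ract (atomic_ract x s) t = atomic_ract x (s * t).
Proof. by apply: val_inj; rewrite /= ractA. Qed.
Fact atomic_ract1 x : atomic_ract x 1 = x.
Proof. by apply: val_inj; rewrite /= ract1. Qed.
Fact atomic_scale_ract s t (x : atomic_module d) :
  s *: atomic_ract x t = atomic_ract (s *: x) t.
Proof. by apply: val_inj; rewrite /= scale_ract. Qed.
HB.instance Definition _ := Lmodule_isBimodule.Build S (atomic_module d)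
  atomic_ractDl atomic_ractDr atomic_ractA atomic_ract1 atomic_scale_ract.
End AtomicBimodule.

Definition generators (d : nat) : bimodType S := atomic_module d.
Local Notation G := (graded_tensor_algebra generators).
Local Notation Wletter := (letter generators).
Local Notation Wl := (mkletter (M := generators)).
Local Notation gpure := (pure (X := words) (M := generators)).
Local Notation gword_ok := (word_ok (X := words) (M := generators)).

Definition atom_pure u l : generators (count opens u) :=
  insubd (0 : atomic_module _) (bpure u l).

Lemma val_atom_pure u l : atom u -> val (atom_pure u l : atomic_module _) = bpure u l.
Proof.
move=> au; rewrite insubdK //; apply/span_predP/span_gen.
by exists u, l.
Qed.

Definition atom_letter u l : Wletter := Wl (atom_pure u l).

Lemma atom_letterD u l m k (x y : bracket_module I k) : atom u ->
  atom_letter u (l ++ Bl (x + y) :: m)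
  = Wl (atom_pure u (l ++ Bl x :: m) + atom_pure u (l ++ Bl y :: m)).
Proof.
move=> au; congr mkletter; apply: val_inj; rewrite raddfD /= !val_atom_pure //.
exact: pure_add.
Qed.

Lemma atom_letter_balance u l m k k' (x : bracket_module I k) s
    (y : bracket_module I k') :
  atom_letter u (l ++ Bl (ract x s) :: Bl y :: m)
  = atom_letter u (l ++ Bl x :: Bl (s *: y) :: m).
Proof. by rewrite /atom_letter /atom_pure pure_balance. Qed.

Lemma atom_letter_scale u s l : atom u ->
  atom_letter u (lscale s l) = Wl (s *: atom_pure u l).
Proof.
move=> au; congr mkletter; apply: val_inj; rewrite /= !val_atom_pure //.
by rewrite scale_pure.
Qed.

Lemma atom_letter_ract u s l : atom u ->
  atom_letter u (rscale l s) = Wl (ract (atom_pure u l) s).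
Proof.
move=> au; congr mkletter; apply: val_inj; rewrite /= !val_atom_pure //.
by rewrite ract_pure.
Qed.

Fixpoint cut (ws : seq (seq token)) l : seq Wletter :=
  match ws with
  | [::] => [::]
  | [:: u] => [:: atom_letter u l]
  | u :: ws' => let k := size (bracket_letters u) in
      atom_letter u (take k l) :: cut ws' (drop k l)
  end.

Lemma cut_cons u ws l : ws != [::] -> cut (u :: ws) l =
  atom_letter u (take (size (bracket_letters u)) l)
  :: cut ws (drop (size (bracket_letters u)) l).
Proof. by case: ws. Qed.

Lemma tag_cut ws l : map tag (cut ws l) = map (count opens) ws.
Proof. by elim: ws l => [|u [|v ws] IHws] l //=; congr cons; exact: IHws. Qed.

Lemma cut_scale ws s k (y : bracket_module I k) m : all atom ws ->
  cut ws (Bl (s *: y) :: m) = lscale s (cut ws (Bl y :: m)).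
Proof.
case: ws => [|u [|v ws]] //= /andP[au _].
  by rewrite -(atom_letter_scale _ (Bl y :: m)).
have : bracket_letters u != [::] by apply/bracket_letters_neq0/asboolP/atom_bracketing.
case: (bracket_letters u) => //= _ r _.
by rewrite -(atom_letter_scale _ (Bl y :: take (size r) m)).
Qed.

Lemma slotwise_cut ws j pre : ws != [::] -> all atom ws ->
  slotwise (fun l => gpure j (pre ++ cut ws l) : G).
Proof.
have H u pre' suf : atom u -> slotwise (fun l => gpure j (pre' ++ atom_letter u l :: suf) : G).
  move=> au; split=> *; first by rewrite atom_letterD // pure_add.
  by rewrite atom_letter_balance.
elim: ws pre => [//|u [|v ws] IHws] pre _.
  by rewrite /= andbT; apply: H.
move=> /andP[au av].
pose f l l' : G := gpure j (pre ++ atom_letter u l :: cut (v :: ws) l').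
apply: (@slotwise_split _ _ _ _ _ f) => [m|l|l m k k' x s y]; rewrite /f.
- exact: H.
- have := IHws (rcons pre (atom_letter u l)) isT av.
  by apply: eq_slotwise => m; rewrite cat_rcons.
have -> : l ++ [:: Bl (ract x s)] = rscale (l ++ [:: Bl x]) s by rewrite rscale_cat.
rewrite atom_letter_ract // cut_scale //.
have : cut (v :: ws) (Bl y :: m) != [::] by case: (ws).
by case: (cut _ _) => [//|[i z] r] _; rewrite pure_balance.
Qed.

Lemma cut_cat us vs l m : us != [::] -> vs != [::] ->
  size l = size (bracket_letters (flatten us)) ->
  cut (us ++ vs) (l ++ m) = cut us l ++ cut vs m.
Proof.
elim: us l => [//|u [|u' us] IHus] l _ v0.
  rewrite /= cats0 => sl; case: vs v0 {IHus} => // v vs _.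
  by rewrite -sl take_size_cat // drop_size_cat.
rewrite [flatten _]/= lettersE size_cat => sl.
set k := size (bracket_letters u) in sl.
have sk : size (take k l) = k by rewrite size_takel // sl leq_addr.
rewrite cat_cons (@cut_cons u (_ ++ _)) // (@cut_cons u (_ :: _)) // -/k cat_cons takel_cat;
  last by rewrite sl leq_addr.
congr cons.
rewrite -{1}(cat_take_drop k l) -catA drop_size_cat //; apply: IHus => //.
by rewrite size_drop sl addKn.
Qed.

Definition to_free : F -> G := tensor_lift (fun (w : bracketings) l =>
  gpure (map (count opens) (pieces w)) (cut (pieces w) l)).

Lemma to_free_multilinear : multilinear (A := G) (fun (w : bracketings) l =>
  gpure (map (count opens) (pieces w)) (cut (pieces w) l)).
Proof.
split=> [w l m k x y|w l m k k' x s y] /bword_okP[/piecesP[aw _ n0] _];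
  have [hD hB] := slotwise_cut (map (count opens) (pieces w)) [::] n0 aw.
- exact: hD.
- exact: hB.
Qed.

HB.instance Definition _ := GRing.isZmodMorphism.Build F G to_free
  (tensor_liftB to_free_multilinear).

Lemma to_freeE w l : bword_ok w l ->
  to_free (bpure w l) = gpure (map (count opens) (pieces w)) (cut (pieces w) l).
Proof. exact: (tensor_liftE to_free_multilinear). Qed.

Lemma cut_ok w l : bracketing w ->
  gword_ok (map (count opens) (pieces w)) (cut (pieces w) l).
Proof.
move=> /piecesP[_ _ n0]; rewrite /word_ok /= tag_cut eqxx andbT.
by case: (pieces w) n0.
Qed.

Lemma to_free_amul (x y : F) : to_free (amul x y) = amul (to_free x) (to_free y).
Proof.
elim/tensor_sum_ind: x => [|x x' hx hx'|u l oku].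
- by rewrite !(amul0l, raddf0).
- by rewrite amulDl amulNl !raddfB /= hx hx' amulDl amulNl.
elim/tensor_sum_ind: y => [|y y' hy hy'|v m okv].
- by rewrite !(amul0r, raddf0).
- by rewrite amulDr amulNr !raddfB /= hy hy' amulDr amulNr.
have [hu eu] := bword_okP _ _ oku; have [hv ev] := bword_okP _ _ okv.
rewrite {1}/amul /= tmulE // !to_freeE ?(word_ok_cat oku okv) //.
rewrite {1}/amul /= tmulE ?cut_ok // pieces_cat // map_cat.
have [_ fu nu] := piecesP hu; have [_ _ nv] := piecesP hv.
by rewrite cut_cat // fu -eu size_map.
Qed.
End Free.

Section FreeInverse.
Variables (S : pzRingType) (V : bimodType S) (I : ideal (tensor_algebra V)).
Local Notation F := (bracket_algebra I).
Local Notation part := (@tensor_part S bool (bracket_module I) bracketings).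
Local Notation bpure := (pure (X := bracketings) (M := bracket_module I)).
Local Notation bword_ok := (word_ok (X := bracketings) (M := bracket_module I)).
Local Notation W := (@generators S V I).
Local Notation G := (graded_tensor_algebra W).
Local Notation Wletter := (letter W).
Local Notation Wl := (mkletter (M := W)).
Local Notation gpure := (pure (X := words) (M := W)).
Local Notation gword_ok := (word_ok (X := words) (M := W)).
Local Notation gpart := (@tensor_part S nat W words).

Definition Wval d (x : W d) : F := val (x : atomic_module I d).

Fixpoint prodW (l : seq Wletter) : F :=
  match l with
  | [::] => 0
  | [:: x] => Wval (tagged x)
  | x :: l' => amul (Wval (tagged x)) (prodW l')
  end.

Lemma prodW_cons x l : l != [::] -> prodW (x :: l) = amul (Wval (tagged x)) (prodW l).
Proof. by case: l. Qed.

Lemma prodW_cat l m : l != [::] -> m != [::] ->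
  prodW (l ++ m) = amul (prodW l) (prodW m).
Proof.
move=> + m0; elim: l => [|x [|y l] IHl] // _; first by rewrite cat1s prodW_cons.
by rewrite cat_cons !(@prodW_cons x) // IHl // amulA.
Qed.

Lemma prodW_scale s l : prodW (lscale s l) = s *: prodW l.
Proof. by case: l => [|x [|y l]] /=; rewrite ?scaler0 // -amul_scalel. Qed.

Lemma prodW_ract s l : prodW (rscale l s) = ract (prodW l) s.
Proof.
elim: l => [|x [|y l] IHl]; rewrite ?ract0l //.
rewrite -[rscale _ _]/(x :: rscale (y :: l) s) prodW_cons; last by case: (l).
by rewrite IHl -amul_ractr.
Qed.

Lemma prodW_multilinear : multilinear (A := F) (fun (j : words) l => prodW l).
Proof.
split=> [_ l m d x y _|_ l m d d' x s y _].
  have e : prodW (Wl (x + y) :: m) = prodW (Wl x :: m) + prodW (Wl y :: m).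
    case: m => [|z m]; first exact: raddfD.
    rewrite !(@prodW_cons _ (z :: m)) // -amulDl; congr amul; exact: raddfD.
  by case: l => [//|z l]; rewrite !prodW_cat // e amulDr.
have e : prodW (Wl (ract x s) :: Wl y :: m) = prodW (Wl x :: Wl (s *: y) :: m).
  rewrite !(@prodW_cons _ (_ :: _)) // -[Wl (s *: y) :: m]/(lscale s (Wl y :: m)).
  by rewrite prodW_scale -amul_balanced.
by case: l => [//|z l]; rewrite !prodW_cat // e.
Qed.

Definition from_free : G -> F := tensor_lift (fun (j : words) l => prodW l).

HB.instance Definition _ := GRing.isZmodMorphism.Build G F from_free
  (tensor_liftB prodW_multilinear).

Lemma from_freeE (j : seq nat) l : gword_ok j l -> from_free (gpure j l) = prodW l.
Proof. exact: (tensor_liftE prodW_multilinear). Qed.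

Lemma from_free_scale s (x : G) : from_free (s *: x) = s *: from_free x.
Proof.
elim/tensor_sum_ind: x => [|x y hx hy|j l ok].
- by rewrite !(scaler0, raddf0).
- by rewrite scalerBr !raddfB /= hx hy.
by rewrite scale_pure !from_freeE ?word_ok_lscale // prodW_scale.
Qed.

Lemma from_free_ract (x : G) s : from_free (ract x s) = ract (from_free x) s.
Proof.
elim/tensor_sum_ind: x => [|x y hx hy|j l ok].
- by rewrite !(ract0l, raddf0).
- by rewrite ractBl !raddfB /= hx hy ractBl.
by rewrite ract_pure !from_freeE ?word_ok_rscale // prodW_ract.
Qed.

Lemma prodW_cut ws l : all atom ws -> ws != [::] -> bword_ok (flatten ws) l ->
  prodW (cut ws l) = bpure (flatten ws) l.
Proof.
elim: ws l => [//|u [|v ws] IHws] l.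
  by rewrite /= andbT cats0 => au _ _; exact: val_atom_pure.
move=> /andP[au aws] _; rewrite [flatten _]/= => ok.
have [||l1 [l2 [-> ok1 ok2]]] := bword_ok_cat_inv _ _ ok.
- exact: atom_bracketing.
- exact: (@atoms_bracketing (v :: ws)).
have /bword_okP[_ /(congr1 size)] := ok1; rewrite size_map => s1.
rewrite cut_cons // -s1 take_size_cat // drop_size_cat // prodW_cons; last by case: (ws).
rewrite IHws // [Wval _]val_atom_pure // /amul /=.
exact: tmulE.
Qed.

Lemma to_freeK : cancel (@to_free S V I) from_free.
Proof.
apply: (tensor_sum_eq (f := from_free \o @to_free S V I) (g := id)) => [x y|//|w l ok].
  by rewrite /= !raddfB.
have [hw _] := bword_okP _ _ ok; have [aw fw n0] := piecesP hw.
by rewrite /= to_freeE // from_freeE ?cut_ok // prodW_cut ?fw.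
Qed.

Lemma to_free_Wval d (x : W d) : to_free (Wval x) = gpure [:: d] [:: Wl x].
Proof.
have pD (y z : W d) : gpure [:: d] [:: Wl (y + z)]
    = gpure [:: d] [:: Wl y] + gpure [:: d] [:: Wl z] by exact: (pure_add _ [::]).
have pB (y z : W d) : gpure [:: d] [:: Wl (y - z)]
    = gpure [:: d] [:: Wl y] - gpure [:: d] [:: Wl z].
  by apply: (addIr (gpure [:: d] [:: Wl z])); rewrite -pD !subrK.
have p0 : gpure [:: d] [:: Wl (0 : W d)] = 0 by rewrite -[in LHS](subrr 0) pB subrr.
have insE (y : atomic_module I d) : insubd (0 : atomic_module I d) (val y) = y.
  exact: valKd.
have ins0 : insubd (0 : atomic_module I d) 0 = 0 := insE 0.
have inA y : Defs.span (@atomic_pure S V I d) y -> y \in @atomic S V I d.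
  by move=> hy; apply/span_predP.
have valIK y : Defs.span (@atomic_pure S V I d) y ->
    val (insubd (0 : atomic_module I d) y) = y.
  by move/inA=> hy; rewrite insubdK.
suff h y : Defs.span (@atomic_pure S V I d) y ->
    to_free y = gpure [:: d] [:: Wl (insubd (0 : atomic_module I d) y : W d)].
  by rewrite h /Wval ?insE //; apply/span_predP; exact: valP.
elim=> [{}y [w [l [aw ew ->]]]||{}y z hy ihy hz ihz].
- have [ok|/pure_eq0 ->] := boolP (bword_ok w l); last first.
    by rewrite raddf0 ins0 p0.
  by rewrite to_freeE // -[w]cats0 -[w ++ _]/(flatten [:: w]) pieces_flatten /= ?aw // cats0 -ew.
- by rewrite raddf0 ins0 p0.
- rewrite raddfB /= ihy ihz -pB; congr (gpure _ [:: Wl _]).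
  apply: val_inj; transitivity (y - z); last by rewrite valIK //; exact: spanB.
  by rewrite raddfB; congr (_ - _); apply: valIK.
Qed.

Lemma to_free_prodW l : l != [::] -> to_free (prodW l) = gpure (map tag l) l.
Proof.
elim: l => [|[d x] [|y l] IHl] // _; first exact: to_free_Wval.
rewrite prodW_cons // to_free_amul IHl // to_free_Wval /amul /= tmulE //.
  by rewrite /word_ok /= eqxx.
by rewrite /word_ok /= eqxx.
Qed.

Lemma from_freeK : cancel from_free (@to_free S V I).
Proof.
apply: (tensor_sum_eq (f := @to_free S V I \o from_free) (g := id)) => [x y|//|j l ok].
  by rewrite /= !raddfB.
have /andP[_ /eqP e] := ok; rewrite /= from_freeE // to_free_prodW ?(word_ok_neq0 ok) //.
by congr (gpure _ _).
Qed.

Lemma to_free_part d x : part d x -> gpart d (to_free x).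
Proof.
have [p0 pB _ _] := part_sub_bimodule W words d.
elim=> [{}x [w /= ew [l ->]]||{}x y _ hx _ hy].
- have [ok|/pure_eq0 ->] := boolP (bword_ok w l); last by rewrite raddf0.
  have [hw _] := bword_okP _ _ ok; have [_ fw _] := piecesP hw.
  by rewrite to_freeE //; apply: part_pure; rewrite /= -count_flatten fw.
- by rewrite raddf0.
- by rewrite raddfB; apply: pB.
Qed.

Lemma Wval_part d (x : W d) : part d (Wval x).
Proof.
have [p0 pB _ _] := part_sub_bimodule (bracket_module I) bracketings d.
have /span_predP : Wval x \in @atomic S V I d by exact: valP.
elim=> [y [w [l [_ ew ->]]]||y z _ hy _ hz]; first exact: part_pure.
- exact: p0.
- exact: pB.
Qed.

Lemma prodW_part l : part (sumn (map tag l)) (prodW l).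
Proof.
elim: l => [|x [|y l] IHl].
- by case: (part_sub_bimodule (bracket_module I) bracketings 0).
- by rewrite /= addn0; exact: Wval_part.
- by rewrite prodW_cons //; apply: part_amul IHl; exact: Wval_part.
Qed.

Lemma from_free_part d x : gpart d x -> part d (from_free x).
Proof.
have [p0 pB _ _] := part_sub_bimodule (bracket_module I) bracketings d.
elim=> [{}x [j /= ej [l ->]]||{}x y _ hx _ hy].
- have [ok|/pure_eq0 ->] := boolP (gword_ok j l); last by rewrite raddf0.
  have /andP[_ /eqP e] := ok.
  by rewrite from_freeE // -ej -[j in sumn j]e; exact: prodW_part.
- by rewrite raddf0.
- by rewrite raddfB; apply: pB.
Qed.

Lemma to_free_isomorphism : graded_isomorphism part gpart (@to_free S V I).
Proof.
split; first by exists from_free; [exact: to_freeK|exact: from_freeK].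
- split; last exact: to_free_amul.
  split=> [x y|s x|x s]; first exact: raddfB.
    by rewrite -{1}[x]to_freeK -from_free_scale from_freeK.
  by rewrite -{1}[x]to_freeK -from_free_ract from_freeK.
- move=> d x; split; first exact: to_free_part.
  by move/from_free_part; rewrite to_freeK.
Qed.
End FreeInverse.

Theorem theorem4p1 (S : pzRingType) (V : bimodType S)
    (I : ideal (tensor_algebra V)) :
  [/\ dg_morphism (augmentation (I := I)),
      quasi_isomorphism (augmentation (I := I))
    & free_resolution (bracket_resolution I) (quotient_algebra I)].
Proof.
have aug_dg := @augmentation_dg_morphism S V I.
have aug_qi := @augmentation_quasi_isomorphism S V I.
split=> //; split.
- exact: bracket_dg_algebra.
- by apply: qis_map aug_qi => //; [exact: bracket_dg_algebra|exact: concentrated_dg_algebra].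
- by exists (@generators S V I), (@to_free S V I); exact: to_free_isomorphism.
Qed.
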